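(* There exists a constant $\eta>0$ such that for every integer $N\ge1$, every $W\in(0,1/2)$ and every integer $n\le N-1$ with $$2NW+\log(\pi NW)+6\le n\le\pi NW,$$ one has $$\widetilde\lambda_{n,N}(W)\le 2\exp\left(-\eta\,\frac{n-2NW}{\log(\pi NW)+5}\right).$$
   Context: For $W\in(0,1/2)$ and an integer $N\ge1$, let $\widetilde Q_{W,N}$ be the positive, self-adjoint integral operator of rank $N$ on $L^2(-W,W)$ given by $$\widetilde Q_{W,N}f(x)=\int_{-W}^{W}\frac{\sin(N\pi(x-y))}{\sin(\pi(x-y))}f(y)\,dy.$$ Its $N$ nonzero eigenvalues, in decreasing order, are denoted $1>\widetilde\lambda_{0,N}(W)>\widetilde\lambda_{1,N}(W)>\cdots>\widetilde\lambda_{N-1,N}(W)>0$. Equivalently, they are the eigenvalues of the $N\times N$ Toeplitz matrix $\left[\frac{\sin(2\pi(n-m)W)}{\pi(n-m)}\right]_{0\le n,m\le N-1}$ (diagonal entries $2W$). Here $\log$ is the natural logarithm. *)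

(* Defs.v *)
From HB Require Import structures.
From mathcomp Require Import all_boot all_order all_algebra.
From mathcomp Require Import all_classical all_reals all_analysis.

Set Implicit Arguments.
Unset Strict Implicit.
Unset Printing Implicit Defensive.
Import Order.TTheory GRing.Theory Num.Theory.
Import numFieldNormedType.Exports.
Local Open Scope classical_set_scope.
Local Open Scope ring_scope.

(* Lebesgue measure restricted to (-W, W).  The space L^2(-W, W) is
   [Lfun (itv_measure W) 2%:E] with functions identified when they agree almost
   everywhere for [itv_measure W]; values of functions outside (-W, W) are thus
   irrelevant.  Scalars are real: the kernel below is real and symmetric, so the
   eigenvalues and their multiplicities are the same as over complex scalars. *)
Definition itv_measure {R : realType} (W : R) :
    {measure set (measurableTypeR R) -> \bar R} :=
  mrestr (@lebesgue_measure R) (measurable_itv `]- W, W[).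

(* sin (N pi t) / sin (pi t), with its continuous extension N at t = 0, which is
   the only singularity that matters, since |x - y| < 1 for x, y in (-W, W) and
   W < 1/2. *)
Definition dpss_kernel {R : realType} (N : nat) (t : R) : R :=
  if t == 0 then N%:R else sin (N%:R * pi * t) / sin (pi * t).

Definition dpss_op {R : realType} (N : nat) (W : R) (f : R -> R) (x : R) : R :=
  \int[@lebesgue_measure R]_(y in `]- W, W[) (dpss_kernel N (x - y) * f y).

(* The eigenspace for mu, the zero function included. *)
Definition in_eigenspace {R : realType} (N : nat) (W mu : R) (f : R -> R) :
    Prop :=
  f \in Lfun (itv_measure W) 2%:E /\
  \forall x \ae itv_measure W, dpss_op N W f x = mu * f x.

(* Linear independence and spanning are modulo a.e. equality, i.e. in L^2(-W, W). *)
Definition eigenspace_dim {R : realType} (N : nat) (W mu : R) (d : nat) : Prop :=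
  exists e : 'I_d -> R -> R,
    [/\ forall i, in_eigenspace N W mu (e i),
        forall c : 'I_d -> R,
          (\forall x \ae itv_measure W, \sum_(i < d) c i * e i x = 0) ->
          forall i, c i = 0
      & forall f : R -> R, in_eigenspace N W mu f ->
          exists c : 'I_d -> R,
            \forall x \ae itv_measure W, f x = \sum_(i < d) c i * e i x].

(* [lam] lists the N nonzero eigenvalues in decreasing order, each repeated
   according to its multiplicity; the last clause at a [mu] outside the list says
   that its eigenspace is zero, so no nonzero eigenvalue is missed.  That the order is in fact strict and that the
   values lie in (0, 1) are theorems, not assumed here. *)
Definition eigenvalue_list {R : realType} (N : nat) (W : R) (lam : 'I_N -> R) :
    Prop :=
  [/\ forall i j : 'I_N, (i <= j)%N -> lam j <= lam i,
      forall i, lam i != 0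
    & forall mu : R, mu != 0 ->
        eigenspace_dim N W mu #|[pred i : 'I_N | lam i == mu]|].

(* Main.v *)
(* The operator has the same nonzero spectrum as the Gram matrix [G] on [-W, W]
   of the N functions [cas], which are orthonormal on every interval of length 1
   and whose reproducing kernel is the Dirichlet kernel D.  Hence on an
   orthonormal frame spanning a space of trigonometric polynomials,
   tr (G (1 - G) G) is the integral over J = [W, 1 - W] of the sum of the squares
   of the projections of the restrictions to [-W, W].

   Cut [-W, W] dyadically towards its endpoints, down to the scale 1 / N; this
   takes B = O (log (N W)) steps.  On each block D (y - z), y in J, is up to a
   factor q ^ K with |q| <= 1 / 2 a sum of O (K) products of functions of y and z,
   and on the last two segments a [cas] is close to a polynomial of degree < K.
   So on the subspace killed by r = 4 B K + 2 K linear functionals the trace above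
   is at most (B + 18) / 4 ^ K by Bessel's inequality, the factor B coming from the
   logarithmic divergence of the integral of D ^ 2 over J x [-W, W].

   On the span of the first n + 1 eigenvectors G (1 - G) G is at least
   lam_n ^ 2 (1 - G), and the trace of G is at most 2 N W on any subspace.
   Therefore lam_n ^ 2 (n + 1 - r - 2 N W) <= (B + 18) / 4 ^ K, and the theorem
   follows by choosing K of order (n - 2 N W) / (log (pi N W) + 5). *)

Require Import Defs.
From HB Require Import structures.
From mathcomp Require Import all_boot all_order all_algebra.
From mathcomp Require Import all_classical all_reals all_analysis.
From mathcomp Require Import measurable_realfun zify ring lra.
Import Order.TTheory GRing.Theory Num.Theory.
Import numFieldNormedType.Exports.
Set Implicit Arguments.
Unset Strict Implicit.
Unset Printing Implicit Defensive.
Local Open Scope classical_set_scope.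
Local Open Scope ring_scope.

(** * Continuous functions on a segment and their integrals *)

Notation cint a b f := (\int[@lebesgue_measure _]_(x in `[a, b]) f x) (only parsing).

Section ContinuousOnSegment.
Context {R : realType}.
Implicit Types (a b c : R) (f g F : R -> R).
Notation mu := (@lebesgue_measure R).

(** Continuity is two-sided at every point, endpoints included, hence stronger than continuity
    within the segment: it combines pointwise and passes to subsegments without boundary cases. *)
Definition cts a b f := forall x, a <= x <= b -> {for x, continuous f}.

Lemma sub_cts a b c d f : a <= c -> d <= b -> cts a b f -> cts c d f.
Proof.
by move=> ac db cf x /andP[cx xd]; apply: cf; rewrite (le_trans ac)//= (le_trans xd).
Qed.

Lemma ctsD a b f g : cts a b f -> cts a b g -> cts a b (fun x => f x + g x).
Proof. by move=> cf cg x xab; apply: cvgD; [exact: cf|exact: cg]. Qed.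

Lemma ctsN a b f : cts a b f -> cts a b (fun x => - f x).
Proof. by move=> cf x xab; apply: cvgN; exact: cf. Qed.

Lemma ctsB a b f g : cts a b f -> cts a b g -> cts a b (fun x => f x - g x).
Proof. by move=> cf cg; apply: ctsD => //; exact: ctsN. Qed.

Lemma ctsM a b f g : cts a b f -> cts a b g -> cts a b (fun x => f x * g x).
Proof. by move=> cf cg x xab; apply: cvgM; [exact: cf|exact: cg]. Qed.

Lemma cts_cst a b (k : R) : cts a b (fun=> k).
Proof. by move=> x _; exact: cvg_cst. Qed.

Lemma cts_id a b : cts a b id.
Proof. by move=> x _; exact: cvg_id. Qed.

Lemma ctsX a b f n : cts a b f -> cts a b (fun x => f x ^+ n).
Proof.
move=> cf; elim: n => [|n IHn]; first exact: cts_cst.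
by rewrite (_ : (fun _ => _) = (fun x => f x * f x ^+ n));
  [exact: ctsM | apply/funext => x; rewrite exprS].
Qed.

Lemma cts_sum a b (I : Type) (r : seq I) (P : pred I) (F : I -> R -> R) :
  (forall i, cts a b (F i)) -> cts a b (fun x => \sum_(i <- r | P i) F i x).
Proof.
move=> cF; elim: r => [|i r IHr].
  by under eq_fun do rewrite big_nil; exact: cts_cst.
under eq_fun do rewrite big_cons; case: (P i) => //; exact: ctsD.
Qed.

Lemma ctsV a b f : (forall x, a <= x <= b -> f x != 0) -> cts a b f ->
  cts a b (fun x => (f x)^-1).
Proof. by move=> f0 cf x xab; apply: cvgV; [exact: f0|exact: cf]. Qed.

Lemma cts_comp a b f g : continuous g -> cts a b f -> cts a b (fun x => g (f x)).
Proof. by move=> cg cf x xab; apply: continuous_comp; [exact: cf|exact: cg]. Qed.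

Lemma cts_sin a b f : cts a b f -> cts a b (fun x => sin (f x)).
Proof. exact/cts_comp/continuous_sin. Qed.

Lemma cts_cos a b f : cts a b f -> cts a b (fun x => cos (f x)).
Proof. exact/cts_comp/continuous_cos. Qed.

Lemma cts_within a b f : cts a b f -> {within `[a, b], continuous f}.
Proof.
by move=> cf; apply: continuous_in_subspaceT => x; rewrite inE/= in_itv/=; exact: cf.
Qed.

Lemma cts_integrable a b f : cts a b f -> mu.-integrable `[a, b] (EFin \o f).
Proof.
move=> cf; apply: continuous_compact_integrable; first exact: segment_compact.
exact: cts_within.
Qed.

Lemma cintD a b f g : cts a b f -> cts a b g ->
  cint a b (fun x => f x + g x) = cint a b f + cint a b g.
Proof. by move=> cf cg; apply: RintegralD => //; exact: cts_integrable. Qed.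

Lemma cintB a b f g : cts a b f -> cts a b g ->
  cint a b (fun x => f x - g x) = cint a b f - cint a b g.
Proof. by move=> cf cg; apply: RintegralB => //; exact: cts_integrable. Qed.

Lemma cintZl a b f k : cts a b f -> cint a b (fun x => k * f x) = k * cint a b f.
Proof. by move=> cf; apply: RintegralZl => //; exact: cts_integrable. Qed.

Lemma cint_sum a b (I : Type) (r : seq I) (F : I -> R -> R) :
  (forall i, cts a b (F i)) ->
  cint a b (fun x => \sum_(i <- r) F i x) = \sum_(i <- r) cint a b (F i).
Proof.
move=> cF; elim: r => [|i r IHr].
  rewrite big_nil; under eq_Rintegral do rewrite big_nil.
  by rewrite Rintegral_cst// mul0r.
rewrite big_cons -IHr; under eq_Rintegral do rewrite big_cons.
by apply: cintD => //; exact: cts_sum.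
Qed.

Lemma eq_cint a b f g : (forall x, a <= x <= b -> f x = g x) ->
  cint a b f = cint a b g.
Proof. by move=> fg; apply: eq_Rintegral => x; rewrite inE/= in_itv/=; exact: fg. Qed.

Lemma le_cint a b f g : cts a b f -> cts a b g ->
  (forall x, a <= x <= b -> f x <= g x) -> cint a b f <= cint a b g.
Proof.
by move=> cf cg fg; apply: le_Rintegral => //; try exact: cts_integrable;
  move=> x /=; rewrite in_itv/=; exact: fg.
Qed.

Lemma cint_ge0 a b f : (forall x, a <= x <= b -> 0 <= f x) -> 0 <= cint a b f.
Proof. by move=> f0; apply: Rintegral_ge0 => x /=; rewrite in_itv/=; exact: f0. Qed.

Lemma cint_cst a b k : a <= b -> cint a b (fun=> k) = k * (b - a).
Proof.
move=> ab; rewrite Rintegral_cst//; congr (_ * _).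
have h : mu `[a, b] = if a < b then (b - a)%:E else 0%E.
  by rewrite [LHS]lebesgue_measure_itv/= lte_fin EFinB.
rewrite -[LHS]/(fine (mu `[a, b])) h.
by case: ltgtP ab => // -> _; rewrite subrr.
Qed.

Lemma cint_cat c a b f : a <= c -> c <= b -> cts a b f ->
  cint a b f = cint a c f + cint c b f.
Proof.
move=> ac cb cf.
have := @Rintegral_itvB R f (BLeft a) (BRight b) c (cts_integrable cf).
rewrite !bnd_simp => /(_ ac cb) /eqP; rewrite subr_eq => /eqP ->.
rewrite Rintegral_itv_obnd_cbnd 1?addrC//.
apply: integrableS (cts_integrable (sub_cts ac (lexx b) cf)) => //=.
by apply: subset_itvr; rewrite bnd_simp.
Qed.

Lemma cint_FTC a b f F : a <= b -> cts a b f ->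
  (forall x, a <= x <= b -> is_derive x 1 F (f x)) -> cint a b f = F b - F a.
Proof.
move=> ab cf dF; case: (ltgtP a b) ab => // [ab _|-> _]; last first.
  by rewrite subrr set_itv1 Rintegral_set1.
have cF x : a <= x <= b -> {for x, continuous F}.
  move=> /dF [dx _]; exact/differentiable_continuous/derivable1_diffP.
have ocF : derivable_oo_LRcontinuous F a b.
  split; first by move=> x /[!in_itv]/= /andP[ax xb]; have [] := dF x _; rewrite ?(ltW ax) ?(ltW xb).
    by apply: cvg_at_right_filter; apply: cF; rewrite lexx ltW.
  by apply: cvg_at_left_filter; apply: cF; rewrite lexx ltW.
rewrite /Rintegral (continuous_FTC2 ab (cts_within cf) ocF)//.
move=> x /[!in_itv]/= /andP[ax xb].
by have [_ dx] := dF x (introT andP (conj (ltW ax) (ltW xb))); rewrite derive1E.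
Qed.

End ContinuousOnSegment.

(** Follows the syntax of the function. Inverses are not decomposed, as they need a nonvanishing
    denominator: their continuity comes from the context or is left as a goal. *)
Ltac cts_tac := try assumption; lazymatch goal with
  | |- cts _ _ (fun _ => ?c) => exact (@cts_cst _ _ _ c)
  | |- cts _ _ (fun x => x) => exact (@cts_id _ _ _)
  | |- cts _ _ (fun x => - @?f x) => apply (@ctsN _ _ _ f); cts_tac
  | |- cts _ _ (fun x => @?f x + @?g x) => apply (@ctsD _ _ _ f g); cts_tac
  | |- cts _ _ (fun x => @?f x * @?g x) => apply (@ctsM _ _ _ f g); cts_tac
  | |- cts _ _ (fun x => @?f x ^+ ?n) => apply (@ctsX _ _ _ f n); cts_tac
  | |- cts _ _ (fun x => sin (@?f x)) => apply (@cts_sin _ _ _ f); cts_tac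
  | |- cts _ _ (fun x => cos (@?f x)) => apply (@cts_cos _ _ _ f); cts_tac
  | |- cts _ _ (fun x => \sum_(i <- _ | _) _) => apply: cts_sum => ?; cts_tac
  | |- _ => idtac
  end.

(** * The real Fourier system and the Dirichlet kernel *)

Section Trigonometric.
Context {R : realType}.
Implicit Types (x y t a b : R) (N k l : nat).

(** For [k < N] the frequencies are symmetric about 0 with spacing 2 pi. When [N] is even they are
    odd multiples of pi: [cas] then changes sign over a unit step, but products of two are still
    1-periodic. *)
Definition freq N k : R := pi * (2 * k%:R + 1 - N%:R).

(** A Hartley function, the real substitute for a complex exponential: in the sum over [k] of
    products at x and y, the sines of x + y cancel by symmetry of the frequencies. *)
Definition cas N k x := cos (freq N k * x) + sin (freq N k * x).

Definition dirichlet N t := \sum_(k < N) cos (freq N k * t).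

Lemma freq_rev N k : (k < N)%N -> freq N (N - k.+1) = - freq N k.
Proof. by move=> kN; rewrite /freq natrB// -natr1; ring. Qed.

Lemma sum_sin_freq N t : \sum_(k < N) sin (freq N k * t) = 0.
Proof.
have : \sum_(k < N) sin (freq N k * t) = - \sum_(k < N) sin (freq N k * t).
  rewrite [LHS](reindex_inj rev_ord_inj) -sumrN /=.
  by apply: eq_bigr => k _; rewrite freq_rev// mulNr sinN.
lra.
Qed.

Lemma casM N k l x y : cas N k x * cas N l y =
  cos (freq N k * x - freq N l * y) + sin (freq N k * x + freq N l * y).
Proof. by rewrite cosB sinD /cas; ring. Qed.

Lemma sum_casM N x y : \sum_(k < N) cas N k x * cas N k y = dirichlet N (x - y).
Proof.
under eq_bigr do rewrite casM -mulrBr -mulrDr.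
by rewrite big_split/= sum_sin_freq addr0.
Qed.

Lemma sum_cas_sqr N x : \sum_(k < N) cas N k x ^+ 2 = N%:R.
Proof.
under eq_bigr do rewrite expr2; rewrite sum_casM subrr /dirichlet.
by under eq_bigr do rewrite mulr0 cos0; rewrite sumr_const card_ord.
Qed.

(** Multiplying by 2 sin (pi t) turns each cosine into a difference of two consecutive sines, and
    the sum telescopes. The product form also covers the zeros of sin (pi t). *)
Lemma dirichlet_sin N t : dirichlet N t * sin (pi * t) = sin (N%:R * pi * t).
Proof.
pose S (k : nat) := sin (pi * (2 * k%:R - N%:R) * t).
have h : 2 * (dirichlet N t * sin (pi * t)) = \sum_(0 <= k < N) (S k.+1 - S k).
  rewrite big_mkord /dirichlet mulr_suml mulr_sumr; apply: eq_bigr => k _.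
  have -> : S k.+1 = sin (freq N k * t + pi * t).
    by rewrite /S /freq -natr1; congr sin; ring.
  have -> : S k = sin (freq N k * t - pi * t) by rewrite /S /freq; congr sin; ring.
  by rewrite sinD sinB; ring.
move: h; rewrite telescope_sumr// /S.
rewrite (_ : pi * (2 * N%:R - N%:R) * t = N%:R * pi * t); last by ring.
rewrite (_ : pi * (2 * 0%:R - N%:R) * t = - (N%:R * pi * t)); last by ring.
by rewrite sinN; lra.
Qed.

Lemma dpss_kernelE N t : `|t| < 1 -> dpss_kernel N t = dirichlet N t.
Proof.
move=> t1; rewrite /dpss_kernel; case: eqVneq => [->|t0].
  rewrite /dirichlet; under eq_bigr do rewrite mulr0 cos0.
  by rewrite sumr_const card_ord.
have s0 : sin (pi * t) != 0.
  wlog tp : t t0 t1 / 0 < t => [hw|].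
    case: (ltgtP 0 t) t0 => // [tp _|tn _]; first by apply: hw; rewrite ?gt_eqF.
    rewrite -oppr_eq0 -sinN -mulrN; apply: hw; rewrite ?normrN// ?oppr_gt0//.
    by rewrite gt_eqF ?oppr_gt0.
  rewrite gt_eqF// sin_gt0_pi//; move: t1; rewrite gtr0_norm// => t1.
  by rewrite mulr_gt0 ?pi_gt0//= -[ltRHS]mulr1 ltr_pM2l ?pi_gt0.
by rewrite -dirichlet_sin mulfK.
Qed.

Lemma sinD_2piz x (m : int) : sin (x + 2 * pi * m%:~R) = sin x.
Proof.
have pn z (n : nat) : sin (z + 2 * pi * n%:R) = sin z :> R.
  by rewrite (_ : 2 * pi * n%:R = pi *+ 2 *+ n) ?(periodicn (@sinD2pi R))//; ring.
case: m => n; first exact: pn.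
rewrite NegzE mulrNz -[LHS](pn _ n.+1) -pmulrn; congr sin; ring.
Qed.

Lemma cosD_2piz x (m : int) : cos (x + 2 * pi * m%:~R) = cos x.
Proof. by rewrite -!sinDpihalf addrAC sinD_2piz. Qed.

Lemma is_derive_affine a b x : is_derive x 1 (fun y => a * y + b) a.
Proof.
rewrite (_ : (fun _ => _) = (a *: (@id R) + cst b : R -> R)); last exact/funext.
by apply: is_derive_eq; rewrite addr0 /GRing.scale/= mulr1.
Qed.

Lemma is_derive_comp_affine (F : R -> R) a b x d :
  is_derive (a * x + b) 1 F d -> is_derive x 1 (fun y => F (a * y + b)) (d * a).
Proof.
move=> dF; have := is_derive_affine a b x.
exact: (@is_derive1_comp _ F (fun y => a * y + b) x d a).
Qed.

Lemma is_derive_scale (F : R -> R) (k : R) x d :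
  is_derive x 1 F d -> is_derive x 1 (fun y => k * F y) (k * d).
Proof. by move=> dF; apply: is_deriveZ. Qed.

Lemma cint_period_cos a (m : int) : m != 0 ->
  cint a (a + 1) (fun x => cos (2 * pi * m%:~R * x)) = 0.
Proof.
move=> m0; have th0 : 2 * pi * m%:~R != 0 :> R.
  by rewrite !mulf_neq0// ?intr_eq0// gt_eqF ?pi_gt0.
pose F x : R := (2 * pi * m%:~R)^-1 * sin (2 * pi * m%:~R * x + 0).
transitivity (F (a + 1) - F a); last first.
  by rewrite /F (mulrDr _ a 1) mulr1 addrAC sinD_2piz addr0; lra.
apply: cint_FTC => [||x _].
- lra.
- by cts_tac.
- apply: (is_derive_eq (is_derive_scale _ (is_derive_comp_affine (is_derive_sin _)))).
  by rewrite addr0 [cos _ * _]mulrC mulKf.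
Qed.

Lemma cint_period_sin a (m : int) :
  cint a (a + 1) (fun x => sin (2 * pi * m%:~R * x)) = 0.
Proof.
have [->|m0] := eqVneq m 0.
  under eq_Rintegral do rewrite mulr0 mul0r sin0.
  by rewrite cint_cst ?mul0r//; lra.
have th0 : 2 * pi * m%:~R != 0 :> R.
  by rewrite !mulf_neq0// ?intr_eq0// gt_eqF ?pi_gt0.
pose F x : R := - (2 * pi * m%:~R)^-1 * cos (2 * pi * m%:~R * x + 0).
transitivity (F (a + 1) - F a); last first.
  by rewrite /F (mulrDr _ a 1) mulr1 addrAC cosD_2piz addr0; lra.
apply: cint_FTC => [||x _].
- lra.
- by cts_tac.
- apply: (is_derive_eq (is_derive_scale _ (is_derive_comp_affine (is_derive_cos _)))).
  by rewrite addr0 mulNr (mulNr (sin _)) mulrN opprK [sin _ * _]mulrC mulKf.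
Qed.

Lemma cts_cas a b N k : cts a b (cas N k).
Proof. by rewrite /cas; cts_tac. Qed.

(** Sums and differences of two frequencies are integer multiples of 2 pi, so both terms of [casM]
    integrate to 0 over a period, except the cosine when [k = l]. *)
Lemma cas_orthonormal N (k l : nat) a :
  cint a (a + 1) (fun x => cas N k x * cas N l x) = (k == l)%:R.
Proof.
under eq_Rintegral do rewrite casM -mulrBl -mulrDl.
rewrite cintD; [|by cts_tac..].
have -> : freq N k + freq N l = 2 * pi * (k%:Z + l%:Z + 1 - N%:Z)%:~R.
  by rewrite /freq !(rmorphB, rmorphD)/=; ring.
have -> : freq N k - freq N l = 2 * pi * (k%:Z - l%:Z)%:~R.
  by rewrite /freq !(rmorphB, rmorphD)/=; ring.
rewrite cint_period_sin addr0; have [->|kl] := eqVneq k l.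
  rewrite subrr mulr0; under eq_Rintegral do rewrite mul0r cos0.
  by rewrite cint_cst ?lerDl// addrAC subrr add0r mul1r.
by rewrite cint_period_cos// subr_eq0 eqz_nat.
Qed.

End Trigonometric.

(** * Bessel's inequality and integrals over chains of segments *)

Section Orthonormal.
Context {R : realType}.
Implicit Types (a b : R).

Lemma cint_sqr_orthonormal (I : finType) (phi : I -> R -> R) (c : I -> R) a b :
    (forall i, cts a b (phi i)) ->
    (forall i j, cint a b (fun x => phi i x * phi j x) = (i == j)%:R) ->
  cint a b (fun x => (\sum_i c i * phi i x) ^+ 2) = \sum_i c i ^+ 2.
Proof.
move=> cphi orth.
transitivity (cint a b (fun x => \sum_i c i * \sum_j c j * (phi i x * phi j x))).
  apply: eq_cint => x _; rewrite expr2 mulr_suml; apply: eq_bigr => i _.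
  by rewrite mulr_sumr mulr_sumr; apply: eq_bigr => j _; ring.
have cij i j : cts a b (fun x => phi i x * phi j x) by exact: ctsM.
have cjs i : cts a b (fun x => \sum_j c j * (phi i x * phi j x)).
  by apply: cts_sum => j; apply: ctsM => //; exact: cts_cst.
rewrite cint_sum; last by move=> i; apply: ctsM => //; exact: cts_cst.
apply: eq_bigr => i _; rewrite cintZl// cint_sum; last first.
  by move=> j; apply: ctsM => //; exact: cts_cst.
rewrite (bigD1 i)//= big1 => [|j ji].
  by rewrite cintZl// orth eqxx mulr1 addr0 expr2.
by rewrite cintZl// orth eq_sym (negPf ji) mulr0.
Qed.

(* Bessel's inequality for the orthonormal family [phi] on [[a, b]], applied to
   the function equal to [g i] on the segment [[l i, r i]]. *)
Lemma piecewise_Bessel (I J : finType) (phi : J -> R -> R) (l r : I -> R)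
    (g : I -> R -> R) a b :
    (forall j, cts a b (phi j)) ->
    (forall i j, cint a b (fun x => phi i x * phi j x) = (i == j)%:R) ->
    (forall i, a <= l i /\ r i <= b) ->
    (forall h, cts a b h -> (forall x, 0 <= h x) ->
       \sum_i cint (l i) (r i) h <= cint a b h) ->
    (forall i, cts (l i) (r i) (g i)) ->
  \sum_j (\sum_i cint (l i) (r i) (fun x => g i x * phi j x)) ^+ 2 <=
  \sum_i cint (l i) (r i) (fun x => g i x ^+ 2).
Proof.
move=> cphi orth lr sub cg.
pose c j := \sum_i cint (l i) (r i) (fun x => g i x * phi j x).
pose Phi x := \sum_j c j * phi j x.
have cphi' i j : cts (l i) (r i) (phi j) by have [al rb] := lr i; exact: sub_cts (cphi j).
have cPhi : cts a b Phi by apply: cts_sum => j; apply: ctsM => //; exact: cts_cst.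
have cPhi' i : cts (l i) (r i) Phi by have [al rb] := lr i; exact: sub_cts cPhi.
have cgphi i j : cts (l i) (r i) (fun x => g i x * phi j x) by exact: ctsM.
have cgP i : cts (l i) (r i) (fun x => g i x * Phi x) by exact: ctsM.
have cg2 i : cts (l i) (r i) (fun x => g i x ^+ 2) by exact: ctsX.
have cP2 i : cts (l i) (r i) (fun x => Phi x ^+ 2) by exact: ctsX.
have h1 : \sum_i cint (l i) (r i) (fun x => g i x * Phi x) = \sum_j c j ^+ 2.
  transitivity (\sum_i \sum_j c j * cint (l i) (r i) (fun x => g i x * phi j x)).
    apply: eq_bigr => i _.
    transitivity (cint (l i) (r i) (fun x => \sum_j c j * (g i x * phi j x))).
      by apply: eq_cint => x _; rewrite mulr_sumr; apply: eq_bigr => j _; ring.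
    rewrite cint_sum; last by move=> j; apply: ctsM => //; exact: cts_cst.
    by apply: eq_bigr => j _; rewrite cintZl.
  by rewrite exchange_big/=; apply: eq_bigr => j _; rewrite -mulr_sumr expr2.
have h2 : \sum_i cint (l i) (r i) (fun x => Phi x ^+ 2) <= \sum_j c j ^+ 2.
  rewrite -(cint_sqr_orthonormal c cphi orth).
  by apply: sub => [|x]; [exact: ctsX|exact: sqr_ge0].
(* [Phi] is the projection of the piecewise function, and the square of the residual is expanded.
   The segments need not cover [[a, b]], hence only an inequality in [h2]. *)
have h3 : 0 <= \sum_i cint (l i) (r i) (fun x => (g i x - Phi x) ^+ 2).
  by apply: sumr_ge0 => i _; apply: cint_ge0 => x _; exact: sqr_ge0.
have h4 : \sum_i cint (l i) (r i) (fun x => (g i x - Phi x) ^+ 2) =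
    \sum_i cint (l i) (r i) (fun x => g i x ^+ 2)
    - 2 * \sum_i cint (l i) (r i) (fun x => g i x * Phi x)
    + \sum_i cint (l i) (r i) (fun x => Phi x ^+ 2).
  rewrite mulr_sumr -sumrB -big_split/=; apply: eq_bigr => i _.
  rewrite -cintZl// -cintB//; last by apply: ctsM => //; exact: cts_cst.
  rewrite -cintD//; last by apply: ctsB => //; apply: ctsM => //; exact: cts_cst.
  by apply: eq_cint => x _; ring.
move: h3; rewrite h4 h1 /c; move: h2; rewrite /c; lra.
Qed.

Lemma cint_telescope (t : nat -> R) n (h : R -> R) :
    (forall i, t i <= t i.+1) -> cts (t 0) (t n) h ->
  \sum_(i < n) cint (t i) (t i.+1) h = cint (t 0) (t n) h.
Proof.
move=> ht; have t0 m : t 0 <= t m by elim: m => // m /le_trans; apply.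
elim: n => [|n IHn] ch; first by rewrite big_ord0 set_itv1 Rintegral_set1.
rewrite big_ord_recr/= IHn; last exact: sub_cts ch.
by rewrite -(@cint_cat _ (t n)).
Qed.

Lemma cint_telescopeN (t : nat -> R) n (h : R -> R) :
    (forall i, t i.+1 <= t i) -> cts (t n) (t 0) h ->
  \sum_(i < n) cint (t i.+1) (t i) h = cint (t n) (t 0) h.
Proof.
move=> ht; have t0 m : t m <= t 0 by elim: m => // m; apply: le_trans.
elim: n => [|n IHn] ch; first by rewrite big_ord0 set_itv1 Rintegral_set1.
rewrite big_ord_recr/= IHn; last exact: sub_cts ch.
by rewrite addrC -(@cint_cat _ (t n)).
Qed.

End Orthonormal.

(** * Polynomial approximation of sines and cosines *)

Section Taylor.
Context {R : realType}.

(** Induction on [K]: the derivative of a cos + b sin is [th] times b cos - a sin, again of this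
    form, so an antiderivative of its approximant serves. Using the mean value theorem gives up the
    factorial in the denominator. *)
Lemma trig_Taylor (K : nat) (a b th : R) :
  exists2 p : {poly R}, (size p <= K)%N &
    forall s, `|a * cos (th * s) + b * sin (th * s) - p.[s]|
              <= (`|a| + `|b|) * `|th * s| ^+ K.
Proof.
elim: K a b => [|K IHK] a b.
  exists 0; first by rewrite size_poly0.
  move=> s; rewrite horner0 subr0 expr0 mulr1.
  apply: (le_trans (ler_normD _ _)); rewrite !normrM lerD//.
    by rewrite -[leRHS]mulr1 ler_wpM2l// cos_max.
  by rewrite -[leRHS]mulr1 ler_wpM2l// sin_max.
have [p sp hp] := IHK b (- a).
(* The antiderivative of [th *: p] with value [a] at 0, so that the error [h] vanishes at 0. *)
pose q : {poly R} := \poly_(i < K.+1) (if i is j.+1 then th * p`_j / j.+1%:R else a).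
have dq : q^`() = th *: p.
  apply/polyP => i; rewrite coef_deriv coef_poly ltnS coefZ.
  case: ltnP => iK; first by rewrite -[LHS]mulr_natr divfK ?pnatr_eq0.
  by rewrite mul0rn nth_default ?mulr0// (leq_trans sp).
exists q; first exact: size_poly.
pose h s := a * cos (th * s) + b * sin (th * s) - q.[s].
have h0 : h 0 = 0.
  by rewrite /h mulr0 cos0 sin0 horner_coef0 coef_poly/=; lra.
pose h' s := th * (b * cos (th * s) + - a * sin (th * s) - p.[s]).
have dh (s : R) : is_derive s 1 h (h' s).
  have d1 : is_derive s 1 (fun s => a * cos (th * s + 0)) (a * (- sin (th * s + 0) * th)).
    exact: (is_derive_scale _ (is_derive_comp_affine (is_derive_cos _))).
  have d2 : is_derive s 1 (fun s => b * sin (th * s + 0)) (b * (cos (th * s + 0) * th)).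
    exact: (is_derive_scale _ (is_derive_comp_affine (is_derive_sin _))).
  have -> : h = (fun s => a * cos (th * s + 0)) + (fun s => b * sin (th * s + 0))
      - (horner q).
    by apply/funext => x; rewrite /h /= !fctE !addr0.
  apply: (is_derive_eq (is_deriveB (is_deriveD d1 d2) (is_derive_poly q s))).
  by rewrite dq hornerZ !addr0 /h'; ring.
have bd s t : `|t| <= `|s| -> `|h' t| <= `|th| * ((`|a| + `|b|) * `|th * s| ^+ K).
  move=> ts; rewrite normrM ler_wpM2l//; apply: (le_trans (hp t)).
  rewrite normrN [`|b| + _]addrC ler_wpM2l ?addr_ge0//.
  by rewrite lerXn2r ?nnegrE// !normrM ler_wpM2l.
have ch x y : {within `[x, y], continuous h}.
  apply: derivable_within_continuous => z _; exact: (@ex_derive _ _ _ _ _ _ _ (dh z)).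
move=> s; rewrite -[X in `|X|]/(h s) exprS mulrCA.
have -> : `|th * s| * ((`|a| + `|b|) * `|th * s| ^+ K) =
   `|th| * ((`|a| + `|b|) * `|th * s| ^+ K) * `|s| by rewrite !normrM; ring.
have [s0|s0] := leP 0 s.
  have [c /[!in_itv]/= /andP[c0 cs]] := MVT_segment s0 (fun x _ => dh x) (ch _ _).
  rewrite h0 !subr0 => ->; rewrite normrM ler_wpM2r// bd//.
  by rewrite !ger0_norm ?(le_trans c0).
have [c /[!in_itv]/= /andP[sc c0]] := MVT_segment (ltW s0) (fun x _ => dh x) (ch _ _).
rewrite h0 !sub0r => /eqP; rewrite eqr_oppLR => /eqP ->.
rewrite normrN normrM normrN ler_wpM2r// bd//.
by rewrite !ler0_norm ?lerN2// ltW.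
Qed.

End Taylor.

(** * Trigonometric inequalities and the integral of the squared kernel *)

Section KernelEstimates.
Context {R : realType}.
Implicit Types (y z c t p W : R).

(** For 0 <= V <= U / 2 and U <= pi / 2 one has sin V <= sin (U - V), and expanding gives 2 cos U
    sin V <= sin U cos V. When cos Y is negative, Y is reflected to pi - Y, whence the second bound
    on |Z|. *)
Lemma cot_tan_le (Y Z : R) : 0 < Y < pi -> `|Z| <= Y / 2 -> `|Z| <= (pi - Y) / 2 ->
  [/\ 0 < sin Y, 0 < cos Z & `|cos Y / sin Y * (sin Z / cos Z)| <= 1 / 2].
Proof.
move=> /andP[Y0 Ypi] ZY ZY'.
have sY : 0 < sin Y by rewrite sin_gt0_pi// Y0.
have cZ : 0 < cos Z.
  by rewrite -cos_norm cos_gt0_pihalf//; have := normr_ge0 Z; lra.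
split=> //.
have key (U V : R) : 0 < U < pi -> 0 <= V -> V <= U / 2 -> 0 <= cos U ->
    2 * (cos U * sin V) <= sin U * cos V.
  move=> /andP[U0 Upi] V0 VU cU.
  have Uh : U <= pi / 2.
    rewrite leNgt; apply/negP => hU; move: cU; rewrite leNgt => /negP; apply.
    by rewrite -oppr_gt0 -sinBpihalf sin_gt0_pi//; lra.
  have sV0 : 0 <= sin V by rewrite sin_ge0_pi// V0/=; lra.
  have h1 : sin V <= sin (U - V).
    by rewrite leNgt ltr_sin ?in_itv/= -?leNgt; lra.
  have h2 : cos U * sin V <= sin V by rewrite ler_piMl// cos_le1.
  by move: h1; rewrite sinB; lra.
have hZ : 2 * (`|cos Y| * `|sin Z|) <= sin Y * cos Z.
  have -> : `|sin Z| = sin `|Z|.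
    have h : 0 <= sin `|Z| by rewrite sin_ge0_pi// normr_ge0/=; lra.
    have [z0|z0] := leP 0 Z.
      by move: h; rewrite ger0_norm// => h; rewrite ger0_norm.
    by move: h; rewrite ltr0_norm// sinN => h; rewrite ler0_norm// -oppr_ge0.
  rewrite -(cos_norm Z); have [cY|cY] := leP 0 (cos Y).
    by rewrite ger0_norm//; apply: key; rewrite ?normr_ge0 ?Y0.
  rewrite ltr0_norm//; have -> : - cos Y = cos (pi - Y) by rewrite cosB cospi sinpi; ring.
  have -> : sin Y = sin (pi - Y) by rewrite sinB cospi sinpi; ring.
  apply: key; rewrite ?normr_ge0//; first lra.
  by rewrite cosB cospi sinpi; lra.
rewrite normrM !normf_div (gtr0_norm sY) (gtr0_norm cZ) mulf_div.
by rewrite ler_pdivrMr ?mulr_gt0//; lra.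
Qed.

Lemma sin_ge_half (x : R) : 0 <= x <= pi / 4 -> x / 2 <= sin x.
Proof.
move=> /andP[x0 x4]; have cs : {within `[0, x], continuous (@sin R)}.
  by apply: cts_within => z _; exact: continuous_sin.
have [c /[!in_itv]/= /andP[c0 cx]] := MVT_segment x0 (fun z _ => is_derive_sin z) cs.
rewrite sin0 !subr0 => ->; rewrite [leLHS]mulrC ler_wpM2r//.
have hp := @pi_gt0 R.
have c4 : 2^-1 <= cos (pi / 4 : R).
  have c40 : 0 <= cos (pi / 4 : R) by rewrite cos_ge0_pihalf//; lra.
  have : cos (pi / 2 : R) = 0 := cos_pihalf R.
  rewrite (_ : pi / 2 = (pi / 4) *+ 2); last by rewrite [RHS]mulr2n; lra.
  rewrite cos_mulr2n => h.
  have {h} : cos (pi / 4 : R) ^+ 2 = 1 / 2 by lra.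
  by move=> h; have := sqr_ge0 (cos (pi / 4 : R) - 2^-1); rewrite sqrrB h; move: (cos_le1 (pi / 4 : R)); nra.
apply: le_trans c4 _; rewrite leNgt ltr_cos ?in_itv/= -?leNgt; lra.
Qed.

Lemma sin_le_id (x : R) : 0 <= x -> sin x <= x.
Proof.
move=> x0; have cs : {within `[0, x], continuous (@sin R)}.
  by apply: cts_within => z _; exact: continuous_sin.
have [c _] := MVT_segment x0 (fun z _ => is_derive_sin z) cs.
rewrite sin0 !subr0 => ->; by rewrite ler_piMl// cos_le1.
Qed.

Definition cot (x : R) := cos x / sin x.

Lemma is_derive_cot (x : R) : sin x != 0 -> is_derive x 1 cot (- (sin x) ^- 2).
Proof.
move=> sx; apply: (is_derive_eq (is_deriveM (is_derive_cos x) (is_deriveV sx (is_derive_sin x)))).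
rewrite /GRing.scale/=; apply: (mulIf (expf_neq0 2 sx)).
rewrite mulrDl [- _ * sin x ^+ 2]mulNr mulVf ?expf_neq0//.
have h := cos2Dsin2 x.
transitivity (- (cos x ^+ 2 + sin x ^+ 2)); last by rewrite h.
by rewrite opprD; congr (_ + _); field.
Qed.

Lemma is_derive_lnsin (x : R) : 0 < sin x -> is_derive x 1 (fun x => ln (sin x)) (cot x).
Proof.
move=> sx; apply: (is_derive_eq (is_derive1_comp (is_derive1_ln sx) (is_derive_sin x))).
by rewrite mulrC.
Qed.

(** For |z| <= p the angle pi (y - z) stays in (0, pi), where cot (pi (y - z)) / pi is an
    antiderivative in z. The integrand majorizes the square of the Dirichlet kernel. *)
Lemma cint_inv_sin_sqr p y W : 0 <= p -> p < W -> W <= y <= 1 - W ->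
  cint (- p) p (fun z => (sin (pi * (y - z)) ^+ 2)^-1) =
  pi^-1 * (cot (pi * (y - p)) - cot (pi * (y + p))).
Proof.
move=> p0 pW /andP[Wy yW]; have hp := @pi_gt0 R.
have s0 z : - p <= z <= p -> 0 < sin (pi * (y - z)).
  move=> /andP[z1 z2]; rewrite sin_gt0_pi//; apply/andP; split; first by rewrite mulr_gt0//; lra.
  by rewrite -[ltRHS]mulr1 ltr_pM2l//; lra.
pose F z : R := pi^-1 * cot (- pi * z + pi * y).
transitivity (F p - F (- p)); last first.
  by rewrite /F mulrBr; congr (_ * cot _ - _ * cot _); ring.
apply: cint_FTC => [||z zp]; first lra.
- apply: ctsV => [z zp|]; first by rewrite expf_neq0// gt_eqF// s0.
  by cts_tac.
- have e : - pi * z + pi * y = pi * (y - z) by ring.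
  have sz : sin (- pi * z + pi * y) != 0 by rewrite e gt_eqF// s0.
  apply: (is_derive_eq (is_derive_scale _ (is_derive_comp_affine (is_derive_cot sz)))).
  by rewrite e mulrNN [_^-1 * pi]mulrC mulKf// gt_eqF.
Qed.

Lemma cts_cot (a b : R) (f : R -> R) : (forall x, a <= x <= b -> sin (f x) != 0) ->
  cts a b f -> cts a b (fun x => cot (f x)).
Proof.
move=> s0 cf; apply: ctsM; first by cts_tac.
by apply: ctsV => //; cts_tac.
Qed.

(** Integrating cot to ln sin gives 2 / pi ^ 2 times ln (sin (pi (W + p)) / sin (pi e)), where e = W
    - p. As e = W / 2 ^ B, the quotient is at most 2 ^ (B + 2), so the growth is only linear in
    [B]. *)
Lemma cint_cot_le (B : nat) p W : 0 < W -> W < 1 / 2 -> (0 < B)%N -> p = W - W / 2 ^+ B ->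
  [/\ cts W (1 - W) (fun y => pi^-1 * (cot (pi * (y - p)) - cot (pi * (y + p))))
    & cint W (1 - W) (fun y => pi^-1 * (cot (pi * (y - p)) - cot (pi * (y + p))))
      <= (B + 2)%:R / 2].
Proof.
move=> W0 W2 B0 ->{p}; set e := W / 2 ^+ B; set p := W - e.
have hp := @pi_gt0 R; have hp2 := pi_ge2 R.
have B2 : 2 <= 2 ^+ B :> R by rewrite -[leLHS]expr1 ler_eXn2l// ltr1n.
have e0 : 0 < e by rewrite divr_gt0// exprn_gt0.
have eW : e <= W / 2 by apply: ler_wpM2l; [exact: ltW|rewrite lef_pV2 ?posrE// exprn_gt0].
have sm y : W <= y <= 1 - W -> 0 < sin (pi * (y - p)).
  move=> /andP[z1 z2]; rewrite sin_gt0_pi//; apply/andP; split; first by rewrite mulr_gt0// /p; lra.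
  by rewrite -[ltRHS]mulr1 ltr_pM2l// /p; lra.
have sp y : W <= y <= 1 - W -> 0 < sin (pi * (y + p)).
  move=> /andP[z1 z2]; rewrite sin_gt0_pi//; apply/andP; split; first by rewrite mulr_gt0// /p; lra.
  by rewrite -[ltRHS]mulr1 ltr_pM2l// /p; lra.
have cm : cts W (1 - W) (fun y => cot (pi * (y - p))).
  by apply: cts_cot => [y /sm/gt_eqF->//|]; cts_tac.
have cp : cts W (1 - W) (fun y => cot (pi * (y + p))).
  by apply: cts_cot => [y /sp/gt_eqF->//|]; cts_tac.
have cc : cts W (1 - W) (fun y => pi^-1 * (cot (pi * (y - p)) - cot (pi * (y + p)))) by cts_tac.
split => //.
pose F y : R := pi^-1 * (pi^-1 * ln (sin (pi * y + pi * (- p)))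
                         - pi^-1 * ln (sin (pi * y + pi * p))).
have -> : cint W (1 - W) (fun y => pi^-1 * (cot (pi * (y - p)) - cot (pi * (y + p)))) =
   F (1 - W) - F W.
  apply: cint_FTC => [||y yW]; [lra|exact: cc|].
  have em : pi * y + pi * - p = pi * (y - p) by ring.
  have ep : pi * y + pi * p = pi * (y + p) by ring.
  have s1 : 0 < sin (pi * y + pi * (- p)) by rewrite em sm.
  have s2 : 0 < sin (pi * y + pi * p) by rewrite ep sp.
  have d1 := is_derive_scale pi^-1 (is_derive_comp_affine (is_derive_lnsin s1)).
  have d2 := is_derive_scale pi^-1 (is_derive_comp_affine (is_derive_lnsin s2)).
  apply: (is_derive_eq (is_derive_scale pi^-1 (is_deriveB d1 d2))).
  by rewrite em ep ![cot _ * pi]mulrC !mulKf// gt_eqF.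
have spi (x : R) : sin (pi - x) = sin x by rewrite sinB sinpi cospi; ring.
have -> : F (1 - W) - F W = 2 / pi ^+ 2 * ln (sin (pi * (W + p)) / sin (pi * e)).
  have se : 0 < sin (pi * e) by rewrite (_ : e = W - p) ?sm// /p; lra.
  have sWp : 0 < sin (pi * (W + p)) by rewrite sp//; lra.
  rewrite ln_div ?posrE// /F.
  rewrite (_ : pi * (1 - W) + pi * - p = pi - pi * (W + p)); last by ring.
  rewrite (_ : pi * (1 - W) + pi * p = pi - pi * e); last by rewrite /p; ring.
  rewrite (_ : pi * W + pi * - p = pi * e); last by rewrite /p; ring.
  rewrite (_ : pi * W + pi * p = pi * (W + p)); last by ring.
  have alg (q A C : R) : q != 0 ->
      q^-1 * (q^-1 * A - q^-1 * C) - q^-1 * (q^-1 * C - q^-1 * A) = 2 / q ^+ 2 * (A - C).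
    by move=> q0; field.
  by rewrite !spi alg// gt_eqF.
have h1 : pi * e / 2 <= sin (pi * e).
  by apply: sin_ge_half; rewrite mulr_ge0 ?(ltW hp) ?(ltW e0)//= ler_pM2l//; lra.
have h2 : sin (pi * (W + p)) <= pi * (2 * W).
  apply: le_trans (sin_le_id _) _; first by apply: mulr_ge0; [exact: ltW|rewrite /p; lra].
  by rewrite ler_pM2l// /p; lra.
have h3 : sin (pi * (W + p)) / sin (pi * e) <= 2 ^+ (B + 2).
  have pe : 0 < pi * e by rewrite mulr_gt0.
  rewrite ler_pdivrMr; last by apply: lt_le_trans h1; lra.
  apply: le_trans h2 _.
  have -> : pi * (2 * W) = 2 ^+ (B + 2) * (pi * e / 2).
    by rewrite exprD /e; field; rewrite gt_eqF// exprn_gt0.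
  by rewrite ler_pM2l// exprn_gt0.
have r0 : 0 < sin (pi * (W + p)) / sin (pi * e).
  rewrite divr_gt0//; first by rewrite sp//; lra.
  by rewrite (_ : e = W - p) ?sm// /p; lra.
have h4 : ln (sin (pi * (W + p)) / sin (pi * e)) <= (B + 2)%:R.
  have : ln (sin (pi * (W + p)) / sin (pi * e)) <= ln (2 ^+ (B + 2)).
    by rewrite ler_ln ?posrE// exprn_gt0.
  move/le_trans; apply; rewrite lnXn// -[ln 2 *+ _]mulr_natr ler_piMl//.
  by have := @le_ln1Dx R 1; rewrite (_ : 1 + 1 = 2)//; apply; lra.
have h5 : 2 / pi ^+ 2 <= 2^-1 :> R.
  by rewrite ler_pdivrMr ?exprn_gt0// expr2; nra.
have [l0|l0] := leP 0 (ln (sin (pi * (W + p)) / sin (pi * e))).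
  rewrite mulrC ler_pM// divr_ge0// exprn_ge0 ?(ltW hp)//.
apply: (@le_trans _ _ 0); last by rewrite divr_ge0.
by rewrite mulr_ge0_le0 ?(ltW l0)// divr_ge0// exprn_ge0 ?(ltW hp).
Qed.

End KernelEstimates.

(** * Gram matrices and traces over orthonormal frames *)

Section Gram.
Context {R : realType}.
Implicit Types (a b W : R) (N d : nat).

(** On [[- W, W]] the sine in [casM] is odd, so the entries are sin (2 pi (k - l) W) / (pi (k - l)),
    with diagonal 2 W: the prolate Toeplitz matrix. *)
Definition gram N a b : 'M[R]_N :=
  \matrix_(k, l) cint a b (fun x => cas N k x * cas N l x).

Definition trigpoly N d (M : 'M[R]_(d, N)) (i : 'I_d) (x : R) : R :=
  \sum_k M i k * cas N k x.

Lemma cts_trigpoly N d (M : 'M[R]_(d, N)) i a b : cts a b (trigpoly M i).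
Proof. by apply: cts_sum => k; apply: ctsM; [exact: cts_cst|exact: cts_cas]. Qed.

Lemma cts_casM N k l a b : cts a b (fun x => cas N k x * cas N l x :> R).
Proof. by apply: ctsM; exact: cts_cas. Qed.

Lemma gram_tr N a b : (gram N a b)^T = gram N a b.
Proof. by apply/matrixP => k l; rewrite !mxE; under eq_Rintegral do rewrite mulrC. Qed.

Lemma gram_quad N d e a b (M : 'M[R]_(d, N)) (P : 'M[R]_(e, N)) i j :
  (M *m gram N a b *m P^T) i j = cint a b (fun x => trigpoly M i x * trigpoly P j x).
Proof.
transitivity (cint a b (fun x => \sum_l \sum_k P j l * (M i k * (cas N k x * cas N l x)))).
  have ck l k : cts a b (fun x => M i k * (cas N k x * cas N l x)).
    by apply: ctsM; [exact: cts_cst|exact: cts_casM].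
  rewrite cint_sum => [|l]; last by apply: cts_sum => k; apply: ctsM => //; exact: cts_cst.
  rewrite mxE; apply: eq_bigr => l _; rewrite cint_sum => [|k]; last by apply: ctsM => //; exact: cts_cst.
  rewrite mxE mulr_suml; apply: eq_bigr => k _.
  by rewrite !cintZl ?mxE; [rewrite mulrC | exact: cts_casM | exact: ck].
apply: eq_cint => x _; rewrite mulrC mulr_suml; apply: eq_bigr => l _.
by rewrite mulr_sumr; apply: eq_bigr => k _; ring.
Qed.

Lemma gram_period N a : gram N a (a + 1) = 1%:M.
Proof. by apply/matrixP => k l; rewrite !mxE cas_orthonormal. Qed.

Lemma gram_cat N c a b : a <= c -> c <= b -> gram N a b = gram N a c + gram N c b.
Proof.
by move=> ac cb; apply/matrixP => k l; rewrite !mxE (cint_cat ac cb)//; exact: cts_casM.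
Qed.

Lemma trigpoly_orthonormal N d (M : 'M[R]_(d, N)) a i j : M *m M^T = 1%:M ->
  cint a (a + 1) (fun x => trigpoly M i x * trigpoly M j x) = (i == j)%:R.
Proof. by move=> MM; rewrite -gram_quad gram_period mulmx1 MM mxE. Qed.

Lemma Bessel_mx N d (M : 'M[R]_(d, N)) (v : 'rV_N) : M *m M^T = 1%:M ->
  \sum_i (v *m M^T) 0 i ^+ 2 <= \sum_k v 0 k ^+ 2.
Proof.
move=> MM; have sqE n (x : 'rV[R]_n) : \sum_k x 0 k ^+ 2 = (x *m x^T) 0 0.
  by rewrite mxE; apply: eq_bigr => k _; rewrite mxE expr2.
have h : 0 <= \sum_k (v - v *m M^T *m M) 0 k ^+ 2 by apply: sumr_ge0 => k _; exact: sqr_ge0.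
move: h; rewrite !sqE [(v - _)^T]linearB/= mulmxBl !mulmxBr !trmx_mul !trmxK.
rewrite !mulmxA -(mulmxA _ M M^T) MM mulmx1 subrr subr0.
by rewrite !mxE subr_ge0.
Qed.

(** By Bessel's inequality for vectors, the squares of the frame functions at a point add up to at
    most the sum of the squares of the [cas], which is [N]; the interval has length 2 W. *)
Lemma trace_gram_le N d (M : 'M[R]_(d, N)) W : 0 <= W -> M *m M^T = 1%:M ->
  \tr (M *m gram N (- W) W *m M^T) <= 2 * N%:R * W.
Proof.
move=> W0 MM; have cM i : cts (- W) W (fun x => trigpoly M i x * trigpoly M i x).
  by apply: ctsM; exact: cts_trigpoly.
rewrite /mxtrace; under eq_bigr do rewrite gram_quad.
rewrite -cint_sum//.
have -> : 2 * N%:R * W = cint (- W) W (fun=> N%:R) by rewrite cint_cst; lra.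
apply: le_cint; [exact: cts_sum|exact: cts_cst|move=> x _].
rewrite -(sum_cas_sqr N x).
have := @Bessel_mx _ _ _ (\row_k cas N k x) MM.
under [X in X <= _ -> _]eq_bigr do rewrite expr2.
under [X in _ <= X -> _]eq_bigr do rewrite mxE.
apply: le_trans; rewrite le_eqVlt; apply/orP; left; apply/eqP; apply: eq_bigr => i _.
have -> : ((\row_k cas N k x) *m M^T) 0 i = trigpoly M i x; last by [].
by rewrite mxE; apply: eq_bigr => k _; rewrite !mxE mulrC.
Qed.

(** The Dirichlet kernel reproduces trigonometric polynomials, so multiplying the coefficients by
    the Gram matrix amounts to restricting to [[a, b]] and projecting back. *)
Lemma trigpoly_gram N d (M : 'M[R]_(d, N)) i a b y :
  trigpoly (M *m gram N a b) i y = cint a b (fun z => dirichlet N (y - z) * trigpoly M i z).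
Proof.
transitivity (cint a b (fun z => \sum_(l < N) cas N l y * (trigpoly M i z * cas N l z))).
  have c1 (l : 'I_N) : cts a b (fun z => trigpoly M i z * cas N l z).
    by apply: ctsM; [exact: cts_trigpoly|exact: cts_cas].
  rewrite cint_sum; last by move=> l; apply: ctsM => //; exact: cts_cst.
  apply: eq_bigr => l _; rewrite cintZl// mulrC; congr (_ * _).
  have -> : (M *m gram N a b) i l = (M *m gram N a b *m 1%:M^T) i l by rewrite trmx1 mulmx1.
  rewrite gram_quad.
  apply: eq_cint => z _; congr (_ * _); rewrite /trigpoly (bigD1 l)//= big1 => [|k kl].
    by rewrite mxE eqxx mul1r addr0.
  by rewrite mxE eq_sym (negPf kl) mul0r.
apply: eq_cint => z _; rewrite -sum_casM mulr_suml; apply: eq_bigr => l _; ring.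
Qed.

(** [1%:M - G] is the Gram matrix of the rest of the period, [[W, 1 - W]], and it is evaluated on
    the rows of [M *m G]. *)
Lemma trace_gram_comp N d (M : 'M[R]_(d, N)) W : 0 <= W -> W <= 1 / 2 ->
  let G := gram N (- W) W in
  \tr (M *m G *m (1%:M - G) *m G *m M^T) =
  \sum_i cint W (1 - W) (fun y => trigpoly (M *m G) i y ^+ 2).
Proof.
move=> W0 W2 G; have -> : 1%:M - G = gram N W (1 - W).
  rewrite -(gram_period N (- W)) [- W + 1]addrC (@gram_cat _ W); [|lra..].
  by rewrite [LHS]addrC addKr.
rewrite /mxtrace; apply: eq_bigr => i _.
have -> : M *m G *m gram N W (1 - W) *m G *m M^T =
    M *m G *m gram N W (1 - W) *m (M *m G)^T.
  by rewrite trmx_mul gram_tr !mulmxA.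
rewrite gram_quad.
by under eq_Rintegral do rewrite -expr2.
Qed.

End Gram.

(** * Dyadic decomposition of the interval and local expansions of the kernel *)

Section LocalApproximation.
Context {R : realType}.
Implicit Types (W y z c : R).

Definition brk W j : R := W - W / 2 ^+ j.

(** The flag [s] selects the right half of the interval, its negation the mirror image. A block has
    midpoint [midc] and is as long as its distance to the nearer endpoint of [[- W, W]]; the edges
    are what remains after [B] blocks on each side. *)
Definition midl W (s : bool) j := if s then brk W j else - brk W j.+1.
Definition midr W (s : bool) j := if s then brk W j.+1 else - brk W j.
Definition midc W (s : bool) j : R :=
  if s then W - 3 / 4 * (W / 2 ^+ j) else - (W - 3 / 4 * (W / 2 ^+ j)).
Definition edgel W B (s : bool) := if s then brk W B else - W.
Definition edger W B (s : bool) := if s then W else - brk W B.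

Lemma brk0 W : brk W 0 = 0.
Proof. by rewrite /brk expr0 divr1 subrr. Qed.

Lemma brkS W j : brk W j.+1 = brk W j + W / 2 ^+ j / 2.
Proof. by rewrite /brk exprS invfM; lra. Qed.

Lemma dyadic_gt0 W j : 0 < W -> 0 < W / 2 ^+ j.
Proof. by move=> W0; rewrite divr_gt0// exprn_gt0. Qed.

Lemma brk_le W j : 0 < W -> brk W j <= brk W j.+1.
Proof. by move=> W0; rewrite brkS; have := dyadic_gt0 j W0; lra. Qed.

Lemma brk_itv W j : 0 < W -> 0 <= brk W j < W.
Proof.
move=> W0; apply/andP; split; last by rewrite /brk; have := dyadic_gt0 j W0; lra.
by elim: j => [|j]; [rewrite brk0|move=> /le_trans; apply; exact: brk_le].
Qed.

Lemma cint_mid W B h : 0 < W -> cts (- brk W B) (brk W B) h ->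
  \sum_(i : bool * 'I_B) cint (midl W i.1 i.2) (midr W i.1 i.2) h =
  cint (- brk W B) (brk W B) h.
Proof.
move=> W0 ch; have /andP[p0 _] := brk_itv B W0.
rewrite -(pair_bigA _ (fun s (j : 'I_B) => cint (midl W s j) (midr W s j) h))/=.
rewrite big_bool/= /midl /midr.
rewrite (cint_telescope (t := brk W)) => [|i|]; [|exact: brk_le|]; last first.
  by apply: sub_cts ch; rewrite ?brk0//; lra.
rewrite (cint_telescopeN (t := fun j => - brk W j)) => [|i|]; last first.
- by apply: sub_cts ch; rewrite ?brk0//; lra.
- by rewrite lerN2; exact: brk_le.
by rewrite brk0 oppr0 addrC -cint_cat//; lra.
Qed.

Lemma cint_mid_edge W B h : 0 < W -> cts (- W) W h ->
  cint (- W) W h =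
  \sum_(i : bool * 'I_B) cint (midl W i.1 i.2) (midr W i.1 i.2) h +
  \sum_s cint (edgel W B s) (edger W B s) h.
Proof.
move=> W0 ch; have /andP[p0 p1] := brk_itv B W0.
rewrite cint_mid//; last by apply: sub_cts ch; lra.
rewrite big_bool/= /edgel /edger (@cint_cat _ (- brk W B)) //; [|lra..].
rewrite (@cint_cat _ (brk W B) (- brk W B)); [|lra|lra|by apply: sub_cts ch; lra].
ring.
Qed.

Lemma mid_sub W s j : 0 < W ->
  - W <= midl W s j /\ midr W s j <= W.
Proof.
move=> W0; have /andP[a b] := brk_itv j W0; have /andP[c d] := brk_itv j.+1 W0.
by rewrite /midl /midr; case: (s); lra.
Qed.

Lemma edge_sub W B s : 0 < W -> - W <= edgel W B s /\ edger W B s <= W.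
Proof. by move=> W0; have /andP[a b] := brk_itv B W0; rewrite /edgel /edger; case: s; lra. Qed.

(** This is q = cot (pi (y - c)) tan (pi (z - c)), chosen because sin (pi (y - z)) = sin (pi (y -
    c)) cos (pi (z - c)) (1 - q). *)
Definition qratio c y z : R :=
  cos (pi * (y - c)) / sin (pi * (y - c)) * (sin (pi * (z - c)) / cos (pi * (z - c))).

(** With d = W / 2 ^ j, z is within d / 4 of the centre, while y - c lies between 3 d / 4 and 1 - 3
    d / 4, so [cot_tan_le] applies. *)
Lemma mid_ratio W s j y z : 0 < W -> W < 1 / 2 -> W <= y <= 1 - W ->
    midl W s j <= z <= midr W s j ->
  let c := midc W s j in
  [/\ 0 < sin (pi * (y - c)), 0 < cos (pi * (z - c)) & `|qratio c y z| <= 1 / 2].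
Proof.
move=> W0 W2 yW zW c; have hp := @pi_gt0 R.
have d0 := dyadic_gt0 j W0; have /andP[b0 _] := brk_itv j W0.
have hz : `|z - c| <= W / 2 ^+ j / 4.
  move: zW; rewrite ler_norml /midl /midr /c /midc brkS /brk.
  by case: (s) => /andP[]; lra.
have hy : 3 / 4 * (W / 2 ^+ j) <= y - c <= 1 - 3 / 4 * (W / 2 ^+ j).
  by move: yW b0; rewrite /c /midc /brk; case: (s) => /andP[]; lra.
move/andP: hy => [hy1 hy2].
apply: cot_tan_le; rewrite ?normrM ?(gtr0_norm hp).
- apply/andP; split; first by rewrite mulr_gt0//; lra.
  by rewrite -[ltRHS]mulr1 ltr_pM2l//; lra.
- by rewrite -mulrA ler_pM2l//; lra.
- by rewrite (_ : pi - pi * (y - c) = pi * (1 - (y - c))) -?mulrA ?ler_pM2l//; [lra|ring].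
Qed.

(** The factors in z of the expansion. Here the flag [s] is not a side: it selects a term of the
    addition formula for sin (N pi (y - z)). *)
Definition mid_weight N c k (s : bool) z : R :=
  (if s then cos (N%:R * pi * z) else sin (N%:R * pi * z))
  * (sin (pi * (z - c)) / cos (pi * (z - c))) ^+ k * (cos (pi * (z - c)))^-1.

(* The expansion of [1 / (1 - q)] in the ratio [q] separates the variables, and
   its remainder after [K] terms is [q ^+ K] times the kernel itself. *)
Lemma dirichlet_expand N K c y z :
    sin (pi * (y - c)) != 0 -> cos (pi * (z - c)) != 0 ->
  dirichlet N (y - z) = qratio c y z ^+ K * dirichlet N (y - z) +
    \sum_(k < K) (cos (pi * (y - c)) / sin (pi * (y - c))) ^+ k / sin (pi * (y - c)) *
      (sin (N%:R * pi * y) * mid_weight N c k true z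
       - cos (N%:R * pi * y) * mid_weight N c k false z).
Proof.
move=> sy cz; set q := qratio c y z.
have h1 : dirichlet N (y - z) * (1 - q) =
    sin (N%:R * pi * (y - z)) / (sin (pi * (y - c)) * cos (pi * (z - c))).
  rewrite -dirichlet_sin -[LHS](mulfK (mulf_neq0 sy cz)); congr (_ / _).
  rewrite -mulrA; congr (_ * _).
  have -> : pi * (y - z) = pi * (y - c) - pi * (z - c) by ring.
  by rewrite sinB /q /qratio; field; rewrite sy cz.
have h2 : dirichlet N (y - z) - q ^+ K * dirichlet N (y - z) =
    dirichlet N (y - z) * (1 - q) * \sum_(k < K) q ^+ k.
  have : 1 - q ^+ K = (1 - q) * \sum_(k < K) q ^+ k.
    by rewrite -[LHS]opprB subrX1 -mulNr opprB.
  by move=> h; rewrite -mulrA -h; ring.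
rewrite -[LHS](subrK (q ^+ K * dirichlet N (y - z))) h2 h1 [LHS]addrC; congr (_ + _).
rewrite mulr_sumr; apply: eq_bigr => k _.
rewrite /q /qratio /mid_weight mulrBr sinB exprMn.
set t1 := (_ / _) ^+ k; set t2 := (_ / _) ^+ k; field.
by rewrite sy cz.
Qed.

Lemma cts_mid_weight N W s j k b : 0 < W -> W < 1 / 2 ->
  cts (midl W s j) (midr W s j) (mid_weight N (midc W s j) k b).
Proof.
move=> W0 W2; have h z : midl W s j <= z <= midr W s j -> cos (pi * (z - midc W s j)) != 0.
  by move=> hz; have [|_ /gt_eqF-> _] := mid_ratio (y := W) W0 W2 _ hz; [lra|].
have cV : cts (midl W s j) (midr W s j) (fun z => (cos (pi * (z - midc W s j)))^-1).
  by apply: ctsV => //; cts_tac.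
by rewrite /mid_weight; case: b; cts_tac.
Qed.

Lemma cts_dirichlet N (a b y : R) : cts a b (fun z => dirichlet N (y - z)).
Proof. by apply: cts_sum => k; cts_tac. Qed.

Lemma cts_ratio W s j y : 0 < W -> W < 1 / 2 ->
  cts (midl W s j) (midr W s j) (qratio (midc W s j) y).
Proof.
move=> W0 W2; have h z : midl W s j <= z <= midr W s j -> cos (pi * (z - midc W s j)) != 0.
  by move=> hz; have [|_ /gt_eqF-> _] := mid_ratio (y := W) W0 W2 _ hz; [lra|].
have cV : cts (midl W s j) (midr W s j) (fun z => (cos (pi * (z - midc W s j)))^-1).
  by apply: ctsV => //; cts_tac.
by rewrite /qratio; cts_tac.
Qed.

(** The vanishing integrals kill the [K] separated terms of [dirichlet_expand] and leave the
    remainder. *)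
Lemma cint_mid_dirichlet N K W s j y f : 0 < W -> W < 1 / 2 -> W <= y <= 1 - W ->
    cts (midl W s j) (midr W s j) f ->
    (forall (k : 'I_K) b,
       cint (midl W s j) (midr W s j) (fun z => mid_weight N (midc W s j) k b z * f z) = 0) ->
  cint (midl W s j) (midr W s j) (fun z => dirichlet N (y - z) * f z) =
  cint (midl W s j) (midr W s j)
    (fun z => qratio (midc W s j) y z ^+ K * dirichlet N (y - z) * f z).
Proof.
move=> W0 W2 yW cf h0; set c := midc W s j.
pose A k := (cos (pi * (y - c)) / sin (pi * (y - c))) ^+ k / sin (pi * (y - c)).
have cw k b : cts (midl W s j) (midr W s j) (fun z => mid_weight N c k b z * f z).
  by apply: ctsM => //; exact: cts_mid_weight.
have cg : cts (midl W s j) (midr W s j) (fun z => qratio c y z ^+ K * dirichlet N (y - z) * f z).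
  apply: ctsM => //; apply: ctsM; last exact: cts_dirichlet.
  by apply: ctsX; exact: cts_ratio.
have ct k : cts (midl W s j) (midr W s j) (fun z =>
      A k * sin (N%:R * pi * y) * (mid_weight N c k true z * f z)
      - A k * cos (N%:R * pi * y) * (mid_weight N c k false z * f z)).
  by apply: ctsB; apply: ctsM => //; exact: cts_cst.
transitivity (cint (midl W s j) (midr W s j) (fun z =>
    qratio c y z ^+ K * dirichlet N (y - z) * f z +
    \sum_(k < K) (A k * sin (N%:R * pi * y) * (mid_weight N c k true z * f z)
      - A k * cos (N%:R * pi * y) * (mid_weight N c k false z * f z)))).
  apply: eq_cint => z hz; have [sy cz _] := mid_ratio W0 W2 yW hz.
  rewrite {1}(@dirichlet_expand N K c) ?gt_eqF// mulrDl mulr_suml; congr (_ + _).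
  by apply: eq_bigr => k _; rewrite /A; ring.
rewrite cintD//; last by apply: cts_sum => k; exact: ct.
rewrite cint_sum; last by move=> k; exact: ct.
rewrite big1 ?addr0// => k _.
by rewrite cintB ?cintZl ?h0 ?mulr0 ?subrr//; apply: ctsM => //; exact: cts_cst.
Qed.

(* Near the endpoints of [[-W, W]] every [cas] is close to a polynomial: the
   segments have length at most [1 / (2 pi N)]. *)
Lemma cas_edge N W B K s (k : 'I_N) : 0 < W -> 2 * pi * N%:R * W <= 2 ^+ B ->
  exists2 p : {poly R}, (size p <= K)%N &
    forall z, edgel W B s <= z <= edger W B s ->
      `|cas N k z - p.[z - edgel W B s]| <= 4 * (1 / 2) ^+ K.
Proof.
move=> W0 hB; set c := edgel W B s; set w : R := freq N k.
(* Addition formula around the left endpoint [c]; the absolute values of the two coefficients add up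
   to at most 4. *)
have [p sp hp] := trig_Taylor K (cos (w * c) + sin (w * c)) (cos (w * c) - sin (w * c)) w.
exists p => // z /andP[z1 z2]; have hpi := @pi_gt0 R.
have -> : cas N k z = (cos (w * c) + sin (w * c)) * cos (w * (z - c))
    + (cos (w * c) - sin (w * c)) * sin (w * (z - c)).
  rewrite /cas -/w; have -> : w * z = w * c + w * (z - c) by ring.
  by rewrite cosD sinD; ring.
apply: (le_trans (hp _)).
have wN : `|w| <= pi * N%:R.
  rewrite /w /freq normrM (gtr0_norm hpi) ler_pM2l// ler_norml.
  have : (k.+1%:R <= N%:R :> R) by rewrite ler_nat.
  by rewrite -natr1; have := ler0n R k; lra.
have zc : `|z - c| <= W / 2 ^+ B.
  rewrite ger0_norm ?subr_ge0//; move: z1 z2; rewrite /c /edgel /edger /brk.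
  by case: (s); lra.
have wz : `|w * (z - c)| <= 1 / 2.
  rewrite normrM; apply: (@le_trans _ _ (pi * N%:R * (W / 2 ^+ B))); first exact: ler_pM.
  by rewrite mulrA ler_pdivrMr ?exprn_gt0//; lra.
apply: ler_pM; rewrite ?addr_ge0 ?exprn_ge0//.
  have := ler_normD (cos (w * c)) (sin (w * c)); have := ler_normB (cos (w * c)) (sin (w * c)).
  by have := cos_max (w * c); have := sin_max (w * c); lra.
by rewrite lerXn2r ?nnegrE//; lra.
Qed.

End LocalApproximation.

(** * The trace of G (1 - G) G on frames killed by the local functionals *)

Section TraceEstimate.
Context {R : realType}.
Variables (N B K : nat) (W : R).

Let G := gram N (- W) W.
(** Left summand: side, block, order, and cosine or sine weight. Right summand: side and degree of a
    monomial moment on an edge. *)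
Let T := (bool * 'I_B * 'I_K * bool + bool * 'I_K)%type.

Let functional (t : T) (h : R -> R) : R :=
  match t with
  | inl (s, j, k, b) =>
      cint (midl W s j) (midr W s j) (fun z => mid_weight N (midc W s j) k b z * h z)
  | inr (s, k) =>
      cint (edgel W B s) (edger W B s) (fun z => (z - edgel W B s) ^+ k * h z)
  end.

Let card_functionals : #|{: T}| = (4 * B * K + 2 * K)%N.
Proof. rewrite card_sum !card_prod card_bool !card_ord; lia. Qed.

(** Its left kernel consists of the coefficient rows of the trigonometric polynomials that all the
    functionals kill. *)
Definition moments : 'M[R]_(N, 4 * B * K + 2 * K) :=
  \matrix_(l, t) functional (enum_val (cast_ord (esym card_functionals) t)) (cas N l).

Hypotheses (W0 : 0 < W) (W2 : W < 1 / 2) (B0 : (0 < B)%N).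
Hypothesis hB : 2 * pi * N%:R * W <= 2 ^+ B.

Lemma cint_weight_trigpoly d (M : 'M[R]_(d, N)) i a b w : cts a b w ->
  cint a b (fun z => w z * trigpoly M i z) =
  \sum_l M i l * cint a b (fun z => w z * cas N l z).
Proof.
move=> cw; have c1 (l : 'I_N) : cts a b (fun z => w z * cas N l z).
  by apply: ctsM => //; exact: cts_cas.
transitivity (cint a b (fun z => \sum_(l < N) M i l * (w z * cas N l z))).
  by apply: eq_cint => z _; rewrite mulr_sumr; apply: eq_bigr => l _; ring.
rewrite cint_sum; last by move=> l; apply: ctsM => //; exact: cts_cst.
by apply: eq_bigr => l _; rewrite cintZl.
Qed.

(** Blocks and edges do not overlap inside one period, which is what [piecewise_Bessel] requires of
    each family. *)
Lemma cint_edge_mid_le h : cts (- W) (- W + 1) h -> (forall x, 0 <= h x) ->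
  \sum_(i : bool * 'I_B) cint (midl W i.1 i.2) (midr W i.1 i.2) h <= cint (- W) (- W + 1) h
  /\ \sum_s cint (edgel W B s) (edger W B s) h <= cint (- W) (- W + 1) h.
Proof.
move: (W0) (W2) => w0 w2 ch h0; have ch' : cts (- W) W h by apply: sub_cts ch; lra.
have := cint_mid_edge B W0 ch'.
rewrite (@cint_cat _ W (- W) (- W + 1)); [|lra|lra|exact: ch].
have := @cint_ge0 R W (- W + 1) h (fun x _ => h0 x).
have : 0 <= \sum_s cint (edgel W B s) (edger W B s) h.
  by apply: sumr_ge0 => s _; exact: cint_ge0.
have : 0 <= \sum_(i : bool * 'I_B) cint (midl W i.1 i.2) (midr W i.1 i.2) h.
  by apply: sumr_ge0 => s _; exact: cint_ge0.
by lra.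
Qed.

Section Frame.
Variables (d : nat) (M : 'M[R]_(d, N)).
Hypotheses (MM : M *m M^T = 1%:M) (MF : M *m moments = 0).

Lemma functional_eq0 i t : functional t (trigpoly M i) = 0.
Proof.
have h : \sum_l M i l * functional t (cas N l) = 0.
  have := congr1 (fun A : 'M[R]_(_, _) => A i (cast_ord card_functionals (enum_rank t))) MF.
  rewrite !mxE; apply: etrans; apply: eq_bigr => l _.
  by rewrite mxE cast_ordK enum_rankK.
rewrite -[RHS]h; case: t h => [[[[s j] k] b]|[s k]] _ /=.
  by apply: cint_weight_trigpoly; exact: cts_mid_weight.
by apply: cint_weight_trigpoly; cts_tac.
Qed.

(** The coefficient along [cas N k] of the projection of [trigpoly M i] restricted to the two
    edges. *)
Let beta i (k : 'I_N) :=
  \sum_s cint (edgel W B s) (edger W B s) (fun z => cas N k z * trigpoly M i z).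

(** For fixed [k] the vanishing moments allow subtracting a polynomial from [cas N k], leaving at
    most 4 / 2 ^ K, and Bessel's inequality bounds the sum over [i]. The sum over [k] brings in N W
    / 2 ^ B <= 1 / 4. *)
Lemma sum_beta_sqr : \sum_i \sum_k beta i k ^+ 2 <= 8 * (1 / 4) ^+ K.
Proof.
move: (W0) (W2) (hB) => w0 w2 hb; have hpi := @pi_gt0 R; have hpi2 := pi_ge2 R.
rewrite exchange_big/=.
apply: (@le_trans _ _ (\sum_(k < N) 32 * (1 / 4) ^+ K * (W / 2 ^+ B))); last first.
  rewrite sumr_const card_ord -[_ *+ N]mulr_natr.
  have h : W / 2 ^+ B * N%:R <= 1 / 4.
    rewrite mulrAC ler_pdivrMr ?exprn_gt0//; have := mulr_ge0 (ltW W0) (ler0n R N); nra.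
  have h4 : 0 <= (1 / 4) ^+ K :> R by rewrite exprn_ge0.
  nra.
apply: ler_sum => k _.
pose p s := projT1 (cid2 (cas_edge K s k W0 hB)).
have sp s : (size (p s) <= K)%N by rewrite /p; case: cid2.
have hp s z : edgel W B s <= z <= edger W B s ->
    `|cas N k z - (p s).[z - edgel W B s]| <= 4 * (1 / 2) ^+ K.
  by rewrite /p; case: cid2 => //= q _; exact.
pose g s z := cas N k z - (p s).[z - edgel W B s].
have cpl (s : bool) (a b : R) : cts a b (fun z => (p s).[z - edgel W B s]).
  rewrite (_ : (fun _ => _) =
    fun z => \sum_(j < K) (p s)`_j * (z - edgel W B s) ^+ j); first by cts_tac.
  by apply/funext => z; rewrite (horner_coef_wide _ (sp s)).
have cg s a b : cts a b (g s) by apply: ctsB; [exact: cts_cas|exact: cpl].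
have gE i : beta i k = \sum_s cint (edgel W B s) (edger W B s) (fun z => g s z * trigpoly M i z).
  apply: eq_bigr => s _.
  transitivity (cint (edgel W B s) (edger W B s) (fun z => g s z * trigpoly M i z +
     \sum_(j < K) (p s)`_j * ((z - edgel W B s) ^+ j * trigpoly M i z))).
    apply: eq_cint => z _; rewrite /g (horner_coef_wide _ (sp s)) mulrBl mulr_suml.
    rewrite -[LHS](subrK (\sum_(j < K) (p s)`_j * (z - edgel W B s) ^+ j * trigpoly M i z)).
    by congr (_ + _); apply: eq_bigr => j _; rewrite mulrA.
  have cj (j : 'I_K) : cts (edgel W B s) (edger W B s)
      (fun z => (z - edgel W B s) ^+ j * trigpoly M i z).
    by apply: ctsM; [cts_tac|exact: cts_trigpoly].
  have cj' (j : 'I_K) : cts (edgel W B s) (edger W B s)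
      (fun z => (p s)`_j * ((z - edgel W B s) ^+ j * trigpoly M i z)).
    by apply: ctsM => //; exact: cts_cst.
  rewrite cintD; [|by apply: ctsM => //; exact: cts_trigpoly|by apply: cts_sum].
  rewrite cint_sum// big1 ?addr0// => j _.
  by rewrite cintZl//; have /= -> := functional_eq0 i (inr (s, j)); rewrite mulr0.
under eq_bigr do rewrite gE.
apply: (le_trans (@piecewise_Bessel R _ _ _ (edgel W B) (edger W B) g (- W) (- W + 1)
    (fun i => @cts_trigpoly _ _ _ M i _ _) (fun i j => trigpoly_orthonormal _ i j MM) _ _ _)).
- by move=> s; have [a b] := edge_sub B s W0; split=> //; lra.
- by move=> h ch h0; exact: (cint_edge_mid_le ch h0).2.
- by [].
have -> : 32 * (1 / 4) ^+ K * (W / 2 ^+ B) = \sum_(s : bool) 16 * (1 / 4) ^+ K * (W / 2 ^+ B).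
  by rewrite big_bool/=; ring.
apply: ler_sum => s _.
have el : edger W B s - edgel W B s = W / 2 ^+ B by rewrite /edger /edgel /brk; case: (s); ring.
rewrite -el -cint_cst; last by rewrite -subr_ge0 el ltW// dyadic_gt0.
apply: le_cint => [||z zs]; [exact: ctsX|exact: cts_cst|].
have := hp s z zs; rewrite -/(g s z) => h.
rewrite -real_normK ?num_real//.
have -> : 16 * (1 / 4) ^+ K = (4 * (1 / 2) ^+ K) ^+ 2 :> R.
  rewrite (_ : 1 / 4 = (1 / 2) ^+ 2 :> R); last by rewrite expr2; lra.
  by rewrite -exprM mulnC exprM; set x := _ ^+ K; ring.
by rewrite lerXn2r ?nnegrE// mulr_ge0// exprn_ge0.
Qed.

Let edge_part i y := \sum_k beta i k * cas N k y.
Let mid_part i y := trigpoly (M *m G) i y - edge_part i y.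

(** The integral in [trigpoly_gram] splits over blocks and edges; the edges give exactly
    [edge_part], and on the blocks only the remainders survive. *)
Lemma mid_partE i y : W <= y <= 1 - W -> mid_part i y =
  \sum_(p : bool * 'I_B) cint (midl W p.1 p.2) (midr W p.1 p.2)
    (fun z => qratio (midc W p.1 p.2) y z ^+ K * dirichlet N (y - z) * trigpoly M i z).
Proof.
move=> yW; rewrite /mid_part trigpoly_gram (cint_mid_edge B W0); last first.
  by apply: ctsM; [exact: cts_dirichlet|exact: cts_trigpoly].
have -> : \sum_s cint (edgel W B s) (edger W B s) (fun z => dirichlet N (y - z) * trigpoly M i z)
    = edge_part i y.
  rewrite /edge_part /beta; under [RHS]eq_bigr do rewrite mulr_suml.
  rewrite exchange_big/=; apply: eq_bigr => s _.
  transitivity (cint (edgel W B s) (edger W B s)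
    (fun z => \sum_(k < N) cas N k y * (cas N k z * trigpoly M i z))).
    by apply: eq_cint => z _; rewrite -sum_casM mulr_suml; apply: eq_bigr => k _; ring.
  have cj (k : 'I_N) a b : cts a b (fun z => cas N k z * trigpoly M i z).
    by apply: ctsM; [exact: cts_cas|exact: cts_trigpoly].
  rewrite cint_sum; last by move=> k; apply: ctsM => //; exact: cts_cst.
  by apply: eq_bigr => k _; rewrite cintZl// mulrC.
rewrite addrK; apply: eq_bigr => -[s j] _ /=.
apply: cint_mid_dirichlet => //; first exact: cts_trigpoly.
by move=> k b; exact: (functional_eq0 i (inl (s, j, k, b))).
Qed.

(** Bessel's inequality over the frame with [y] fixed; then |q| <= 1 / 2 and |D (y - z)| <= 1 / sin
    (pi (y - z)). *)
Lemma sum_mid_part_sqr y : W <= y <= 1 - W ->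
  \sum_i mid_part i y ^+ 2 <=
  (1 / 4) ^+ K * (pi^-1 * (cot (pi * (y - brk W B)) - cot (pi * (y + brk W B)))).
Proof.
move: (W0) (W2) => w0 w2 yW; have hpi := @pi_gt0 R; have /andP[b0 bW] := brk_itv B W0.
pose g (p : bool * 'I_B) z := qratio (midc W p.1 p.2) y z ^+ K * dirichlet N (y - z).
have cg (p : bool * 'I_B) : cts (midl W p.1 p.2) (midr W p.1 p.2) (g p).
  by apply: ctsM; [apply: ctsX; exact: cts_ratio|exact: cts_dirichlet].
under eq_bigr do rewrite mid_partE//.
apply: (le_trans (@piecewise_Bessel R _ _ _ (fun p : bool * 'I_B => midl W p.1 p.2) (fun p => midr W p.1 p.2)
    g (- W) (- W + 1) (fun i => @cts_trigpoly _ _ _ M i _ _)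
    (fun i j => trigpoly_orthonormal _ i j MM) _ _ cg)).
- by move=> [s j]; have [a b] := mid_sub s j W0; split=> //=; lra.
- by move=> h ch h0; exact: (cint_edge_mid_le ch h0).1.
have s0 z : - W < z < W -> 0 < sin (pi * (y - z)).
  move=> /andP[z1 z2]; move: yW => /andP[y1 y2].
  rewrite sin_gt0_pi//; apply/andP; split; first by rewrite mulr_gt0//; lra.
  by rewrite -[ltRHS]mulr1 ltr_pM2l//; lra.
have ci a b : - W < a -> b < W -> cts a b (fun z => (sin (pi * (y - z)) ^+ 2)^-1).
  move=> Wa bW'; apply: ctsV => [z /andP[az zb]|]; last by cts_tac.
  by rewrite expf_neq0// gt_eqF// s0// (lt_le_trans Wa)//= (le_lt_trans zb).
have lrW s j : - W < midl W s j /\ midr W s j < W.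
  have /andP[c1 c2] := brk_itv j W0; have /andP[c3 c4] := brk_itv j.+1 W0.
  by rewrite /midl /midr; case: s; lra.
rewrite -(@cint_inv_sin_sqr R _ _ W)// -cint_mid//; last by apply: ci; lra.
rewrite mulr_sumr; apply: ler_sum => -[s j] _ /=.
have [lW rW] := lrW s j; rewrite -cintZl; last exact: ci.
apply: le_cint => [||z zs].
- by apply: ctsX; exact: (cg (s, j)).
- by apply: ctsM; [exact: cts_cst|exact: ci].
have [_ _ q2] := mid_ratio W0 W2 yW zs.
rewrite exprMn ler_pM ?sqr_ge0//.
  rewrite -exprM mulnC exprM lerXn2r ?nnegrE ?sqr_ge0//.
  rewrite -real_normK ?num_real// (_ : 1 / 4 = (1 / 2) ^+ 2); last by rewrite expr2; lra.
  by rewrite lerXn2r ?nnegrE.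
have sz : 0 < sin (pi * (y - z)).
  by move/andP: zs => [z1 z2]; rewrite s0// (lt_le_trans lW)//= (le_lt_trans z2).
rewrite -[leRHS]mul1r ler_pdivlMr ?exprn_gt0// -exprMn dirichlet_sin.
by rewrite -real_normK ?num_real// expr_le1// sin_max.
Qed.

(** By (a + b) ^ 2 <= 2 a ^ 2 + 2 b ^ 2 the blocks contribute B + 2 and the edges 16. The edge part
    is integrated over a full period, where Parseval's identity holds. *)
Lemma trace_moments_le :
  \tr (M *m G *m (1%:M - G) *m G *m M^T) <= (B + 18)%:R * (1 / 4) ^+ K.
Proof.
move: (W0) (W2) => w0 w2; have ce i a b : cts a b (edge_part i).
  by apply: cts_sum => k; apply: ctsM; [exact: cts_cst|exact: cts_cas].
have ct i a b : cts a b (trigpoly (M *m G) i) by exact: cts_trigpoly.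
have cm i a b : cts a b (mid_part i) by exact: ctsB.
have [cc hc] := cint_cot_le W0 W2 B0 erefl.
rewrite trace_gram_comp; [|lra..].
have h1 : \sum_i cint W (1 - W) (fun y => edge_part i y ^+ 2) <= 8 * (1 / 4) ^+ K.
  apply: le_trans sum_beta_sqr; apply: ler_sum => i _.
  rewrite -(@cint_sqr_orthonormal R _ (fun k : 'I_N => cas N k) _ (- W) (- W + 1)); last 2 first.
  - by move=> k; exact: cts_cas.
  - by move=> k l; exact: cas_orthonormal.
  rewrite [- W + 1]addrC (@cint_cat _ W (- W) (1 - W)); [|lra|lra|by apply: ctsX; exact: ce].
  by rewrite lerDr cint_ge0// => x _; exact: sqr_ge0.
have h2 : \sum_i cint W (1 - W) (fun y => mid_part i y ^+ 2) <= (1 / 4) ^+ K * ((B + 2)%:R / 2).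
  rewrite -cint_sum; last by move=> i; exact: ctsX.
  apply: (@le_trans _ _ (cint W (1 - W) (fun y => (1 / 4) ^+ K *
    (pi^-1 * (cot (pi * (y - brk W B)) - cot (pi * (y + brk W B))))))).
    apply: le_cint; first by apply: cts_sum => i; exact: ctsX.
      by apply: ctsM => //; exact: cts_cst.
    exact: sum_mid_part_sqr.
  by rewrite cintZl// ler_wpM2l ?exprn_ge0.
apply: (@le_trans _ _ (\sum_i (2 * cint W (1 - W) (fun y => mid_part i y ^+ 2)
    + 2 * cint W (1 - W) (fun y => edge_part i y ^+ 2)))).
  apply: ler_sum => i _.
  rewrite -!cintZl; [|by apply: ctsX; by []..].
  rewrite -cintD; [|by apply: ctsM; [exact: cts_cst|exact: ctsX]..].
  apply: le_cint => [||y _]; [exact: ctsX| |].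
    by apply: ctsD; apply: ctsM; [exact: cts_cst|exact: ctsX|exact: cts_cst|exact: ctsX].
  have -> : trigpoly (M *m G) i y = mid_part i y + edge_part i y by rewrite /mid_part; ring.
  by have := sqr_ge0 (mid_part i y - edge_part i y); nra.
rewrite big_split/= -!mulr_sumr.
by move: h1 h2; rewrite !natrD; lra.
Qed.

End Frame.
End TraceEstimate.

(** * Orthonormal bases and the linear algebra of the trace argument *)

Section Orthonormalization.
Context {R : rcfType}.

(** Gram-Schmidt: the first row is made orthogonal to an orthonormal basis of the span of the
    others, and the residual [w] is nonzero by the rank of [U]. *)
Lemma orthonormal_basis (N m : nat) (U : 'M[R]_(m, N)) : row_free U ->
  exists2 Q : 'M[R]_(m, N), Q *m Q^T = 1%:M & (Q <= U)%MS.
Proof.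
elim: m U => [|m IHm] U; first by exists U => //; rewrite [LHS]flatmx0 [RHS]flatmx0.
rewrite -[U](@vsubmxK _ 1 m); set u := usubmx _; set V := dsubmx _ => fU.
have rV : (\rank V <= m)%N := rank_leq_row V.
have rU : (\rank (col_mx u V) = m.+1)%N by apply/eqP.
have fV : row_free V.
  rewrite /row_free eqn_leq rV /= -ltnS -rU -addsmxE.
  apply: leq_trans (mxrank_adds_leqif u V).1 _.
  by rewrite -[leqRHS]/(1 + \rank V)%N leq_add2r rank_leq_row.
have [Q OO QV] := IHm V fV.
pose w := u - u *m Q^T *m Q.
have wO : w *m Q^T = 0 by rewrite mulmxBl -(mulmxA _ Q) OO mulmx1 subrr.
have w0 : w != 0.
  apply/eqP => /eqP; rewrite subr_eq0 => /eqP uO.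
  have uV : (u <= V)%MS by rewrite uO (submx_trans (submxMl _ _)).
  have : (\rank (col_mx u V) <= m)%N.
    by rewrite -addsmxE (addsmx_idPr uV).
  by rewrite rU ltnn.
have ww : w *m w^T = (\sum_k w 0 k ^+ 2)%:M.
  move: (w) => x; apply/matrixP => i j; rewrite !ord1 !mxE mulr1n.
  by apply: eq_bigr => k _; rewrite mxE expr2.
set s := \sum_k _ in ww.
have s0 : 0 < s.
  rewrite lt_neqAle sumr_ge0 ?andbT => [|k _]; last exact: sqr_ge0.
  apply: contra w0 => /eqP/esym/eqP; rewrite psumr_eq0 => [/allP h|k _]; last exact: sqr_ge0.
  apply/eqP/rowP => k; rewrite [RHS]mxE; apply/eqP.
  by have := h k (mem_index_enum _); rewrite sqrf_eq0.
pose o : 'rV[R]_N := (Num.sqrt s)^-1 *: w.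
have oQ : col_mx o Q *m (col_mx o Q)^T = 1%:M :> 'M[R]_(1 + m).
  rewrite tr_col_mx mul_col_row /o !linearZ/= -!scalemxAl ww wO scaler0 OO.
  have -> : Q *m w^T = 0 by rewrite -[LHS]trmxK trmx_mul trmxK wO trmx0.
  rewrite scaler0 scalerA -invfM -expr2 sqr_sqrtr ?ltW// scale_scalar_mx mulVf ?gt_eqF//.
  by rewrite -scalar_mx_block.
have VU : (V <= col_mx u V)%MS by rewrite -addsmxE addsmxSr.
have uU : (u <= col_mx u V)%MS by rewrite -addsmxE addsmxSl.
have QU := submx_trans QV VU.
have oQU : (col_mx o Q <= col_mx u V)%MS.
  rewrite col_mx_sub QU andbT scalemx_sub// addmx_sub// eqmx_opp.
  exact: submx_trans (submxMl _ _) QU.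
by exists (col_mx o Q).
Qed.

(** Each eigenspace is orthonormalized on its own, and symmetry makes different ones orthogonal. The
    multiplicities in [lam] add up to [N], so the frame is a full basis. *)
Lemma symmetric_eigenbasis (N : nat) (G : 'M[R]_N) (lam : 'I_N -> R) :
    G^T = G ->
    (forall i, exists2 E : 'M[R]_(#|[pred j | lam j == lam i]|, N),
       row_free E & E *m G = lam i *: E) ->
  exists2 V : 'M[R]_N, V *m V^T = 1%:M & V *m G = diag_mx (\row_i lam i) *m V.
Proof.
move=> Gsym hE.
(* The eigenvectors for [mu] are placed at the indices [i] with [lam i = mu]. *)
have hw mu : exists w : 'I_N -> 'rV[R]_N, forall j, lam j = mu ->
    w j *m G = mu *: w j /\
    forall k, lam k = mu -> w j *m (w k)^T = (j == k)%:R%:M.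
  case: (pickP [pred j | lam j == mu]) => [i /eqP <-|h]; last first.
    by exists (fun=> 0) => j jmu; have := h j; rewrite /= jmu eqxx.
  have [E fE EG] := hE i; have [Q OO /submxP[D OD]] := orthonormal_basis fE.
  have OG : Q *m G = lam i *: Q by rewrite OD -mulmxA EG scalemxAr.
  have iP : i \in [pred j | lam j == lam i] by rewrite inE.
  exists (fun j => row (enum_rank_in iP j) Q) => j ji; split.
    by rewrite -row_mul OG linearZ.
  move=> k ki.
  have rk_eq : (enum_rank_in iP j == enum_rank_in iP k) = (j == k).
    apply/eqP/eqP => [|->//]; apply: enum_rank_in_inj; rewrite inE; exact/eqP.
  apply/matrixP => a b; rewrite !ord1 mxE [RHS]mxE mulr1n -rk_eq.
  have := congr1 (fun A : 'M[R]_(_, _) => A (enum_rank_in iP j) (enum_rank_in iP k)) OO.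
  by rewrite !mxE => <-; apply: eq_bigr => l _; rewrite !mxE.
pose w mu := projT1 (cid (hw mu)).
have wP mu j : lam j = mu -> w mu j *m G = mu *: w mu j /\
    forall k, lam k = mu -> w mu j *m (w mu k)^T = (j == k)%:R%:M.
  by rewrite /w; case: cid => //= v; exact.
pose v j := w (lam j) j.
have vG j : v j *m G = lam j *: v j by have [] := wP _ j erefl.
have vv j k : v j *m (v k)^T = (j == k)%:R%:M.
  have [jk|jk] := eqVneq (lam j) (lam k).
    by rewrite /v -jk; have [_] := wP _ j erefl; apply.
  have h : lam j *: (v j *m (v k)^T) = lam k *: (v j *m (v k)^T).
    by rewrite scalemxAl -vG -mulmxA -{1}Gsym -trmx_mul vG linearZ/= scalemxAr.
  have -> : (j == k) = false by apply: contra_neqF jk => /eqP ->.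
  rewrite [RHS](raddf0 (@scalar_mx R 1)); apply/eqP.
  by move/eqP: h; rewrite -subr_eq0 -scalerBl scaler_eq0 subr_eq0 (negPf jk).
exists (\matrix_j v j).
  apply/matrixP => j k; rewrite !mxE.
  have := congr1 (fun A : 'M[R]_1 => A 0 0) (vv j k); rewrite !mxE mulr1n => <-.
  by apply: eq_bigr => l _; rewrite !mxE.
by apply/row_matrixP => j; rewrite row_mul rowK vG mul_diag_mx; apply/rowP => k; rewrite !mxE.
Qed.

(** Inside the span of [p] eigenvectors, those killed by [F] form a space of dimension d >= p - r.
    There the trace of G (1 - G) G is a weighted sum of l ^ 2 (1 - l) >= l0 ^ 2 (1 - l), and the
    same weights on 1 - l give d minus the trace of G. *)
Lemma trace_lower_bound (N p r : nat) (G : 'M[R]_N) (F : 'M[R]_(N, r))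
    (V : 'M[R]_(p, N)) (l : 'I_p -> R) (l0 t C : R) :
    G^T = G -> V *m V^T = 1%:M -> V *m G = diag_mx (\row_i l i) *m V ->
    0 <= l0 -> (forall i, l0 <= l i <= 1) ->
    (forall d (M : 'M[R]_(d, N)), M *m M^T = 1%:M -> \tr (M *m G *m M^T) <= t) ->
    (forall d (M : 'M[R]_(d, N)), M *m M^T = 1%:M -> M *m F = 0 ->
       \tr (M *m G *m (1%:M - G) *m G *m M^T) <= C) ->
  l0 ^+ 2 * ((p - r)%:R - t) <= C.
Proof.
move=> Gs VV VG l00 hl ht hC.
set D := diag_mx _ in VG.
have [Q QQ QK] := orthonormal_basis (row_base_free (kermx (V *m F))).
set d := \rank _ in Q QQ QK.
have dpr : (p - r <= d)%N by rewrite /d mxrank_ker leq_sub2l// rank_leq_col.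
pose M := Q *m V.
have MM : M *m M^T = 1%:M by rewrite trmx_mul mulmxA -(mulmxA Q) VV mulmx1.
have MF : M *m F = 0.
  by rewrite -mulmxA; apply/sub_kermxP; rewrite (submx_trans QK)// eq_row_base.
have MG : M *m G = Q *m D *m V by rewrite /M -(mulmxA Q V) VG mulmxA.
have GVT : G *m V^T = V^T *m D.
  by rewrite -{1}Gs -trmx_mul VG trmx_mul tr_diag_mx.
have e1 : \tr (M *m G *m M^T) = \sum_j \sum_i Q j i ^+ 2 * l i.
  rewrite MG trmx_mul mulmxA -(mulmxA _ V) VV mulmx1.
  apply: eq_bigr => j _; rewrite mxE; apply: eq_bigr => i _.
  by rewrite mul_mx_diag !mxE; ring.
have e2 : \tr (M *m G *m (1%:M - G) *m G *m M^T) =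
    \sum_j \sum_i Q j i ^+ 2 * (l i ^+ 2 * (1 - l i)).
  have -> : M *m G *m (1%:M - G) *m G *m M^T = Q *m D *m (1%:M - D) *m D *m Q^T.
    have h1 : M *m G *m (1%:M - G) = Q *m D *m (1%:M - D) *m V.
      rewrite MG !mulmxBr !mulmx1 mulmxBl; congr (_ - _).
      by rewrite -(mulmxA _ V) VG mulmxA.
    rewrite h1 -(mulmxA _ V) VG /M trmx_mul !mulmxA.
    by rewrite -(mulmxA _ V) VV mulmx1.
  have -> : 1%:M - D = diag_mx (\row_i (1 - l i)).
    by apply/matrixP => i j; rewrite !mxE; case: eqP => [->|]; rewrite ?mulr1n ?mulr0n ?subrr.
  apply: eq_bigr => j _; rewrite mxE; apply: eq_bigr => i _.
  by rewrite !mul_mx_diag !mxE; ring.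
have e3 : \sum_j \sum_i Q j i ^+ 2 = d%:R :> R.
  transitivity (\tr (Q *m Q^T)).
    by apply: eq_bigr => j _; rewrite mxE; apply: eq_bigr => i _; rewrite mxE expr2.
  by rewrite QQ mxtrace1.
apply: le_trans (hC _ _ MM MF); rewrite e2.
apply: (@le_trans _ _ (l0 ^+ 2 * (d%:R - t))).
  by rewrite ler_wpM2l ?sqr_ge0// lerD2r ler_nat.
apply: (@le_trans _ _ (l0 ^+ 2 * (d%:R - \tr (M *m G *m M^T)))).
  by rewrite ler_wpM2l ?sqr_ge0// lerD2l lerN2 ht.
rewrite e1 -e3 -sumrB mulr_sumr; apply: ler_sum => j _.
rewrite -sumrB mulr_sumr; apply: ler_sum => i _.
have /andP[h1 h2] := hl i.
rewrite -[X in X - _]mulr1 -mulrBr mulrCA ler_wpM2l ?sqr_ge0// ler_wpM2r ?subr_ge0//.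
by rewrite lerXn2r ?nnegrE// (le_trans l00).
Qed.

End Orthonormalization.

(** * From the integral operator to the Gram matrix *)

Section SpectralBridge.
Context {R : realType}.
Variables (N : nat) (W : R).
Notation mu := (@lebesgue_measure R).
Let D : set R := `]- W, W[.

Let mD : measurable D := measurable_itv _.

Lemma itv_measureE (A : set R) : itv_measure W A = mu (A `&` D).
Proof. by []. Qed.

(** The measure is finite, so L ^ 2 lies in L ^ 1, and it agrees with Lebesgue measure on subsets of
    [D]. *)
Lemma integrable_itv_measure (f : R -> R) :
  f \in Lfun (itv_measure W) 2%:E -> mu.-integrable D (EFin \o f).
Proof.
move=> lf; have fin : itv_measure W setT \is a fin_num.
  rewrite itv_measureE setTI ge0_fin_numE//.
  rewrite [ltLHS](_ : _ = mu `]- W, W[%classic)//.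
  by rewrite [ltLHS]lebesgue_measure_itv/=; case: ifP => // _; rewrite -EFinB ltry.
have /Lfun1_integrable fi := Lfun_subset12 fin lf.
have /integrableP[mf fD] : (itv_measure W).-integrable D (EFin \o f).
  by apply: integrableS fi.
apply/integrableP; split => //; apply: le_lt_trans fD.
rewrite le_eqVlt; apply/orP; left; apply/eqP; apply: eq_measure_integral => A mA AD.
by rewrite [RHS]itv_measureE (setIidl AD).
Qed.

Lemma ae_itv_measureP (P : R -> Prop) :
  (\forall x \ae itv_measure W, P x) -> \forall x \ae mu, D x -> P x.
Proof.
move=> [A [mA A0 PA]]; exists (A `&` D); split.
- exact: measurableI.
- by rewrite -[LHS]itv_measureE.
- move=> x /= /not_implyP[Dx nPx]; split => //; exact: PA.
Qed.

Lemma ae_itv_measure_in : \forall x \ae itv_measure W, D x.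
Proof.
exists (~` D); split; [exact: measurableC| |by move=> x].
by rewrite itv_measureE setICl measure0.
Qed.

Lemma integrable_cts (f : R -> R) : cts (- W) W f -> mu.-integrable D (EFin \o f).
Proof.
move=> cf; apply: integrableS (cts_integrable cf) => //.
by apply: subset_itv; rewrite bnd_simp.
Qed.

Lemma integrable_casM (f : R -> R) k :
  mu.-integrable D (EFin \o f) -> mu.-integrable D (EFin \o (fun y => cas N k y * f y)).
Proof.
move=> fi; have mc : measurable_fun D (@cas R N k).
  by apply/measurable_EFinP; apply: (measurable_int mu); apply: integrable_cts; exact: cts_cas.
rewrite (_ : EFin \o _ = (EFin \o cas N k) \* (EFin \o f))%E; last first.
  by apply/funext => x; rewrite /= EFinM.
apply: integrableMr => //; exists 2; split => // M M2 x _ /=.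
apply: le_trans (ltW M2); apply: (le_trans (ler_normD _ _)).
by have := cos_max (freq N k * x); have := sin_max (freq N k * x); lra.
Qed.

Definition moment (f : R -> R) k : R := \int[mu]_(y in D) (cas N k y * f y).

Lemma Rintegral_sumZ (I : Type) (r : seq I) (c : I -> R) (g : I -> R -> R) :
  (forall i, mu.-integrable D (EFin \o g i)) ->
  \int[mu]_(y in D) (\sum_(i <- r) c i * g i y) =
  \sum_(i <- r) c i * \int[mu]_(y in D) g i y.
Proof.
move=> gi; elim: r => [|i r IHr].
  rewrite big_nil; under eq_Rintegral do rewrite big_nil.
  by rewrite Rintegral_cst// mul0r.
have ci j : mu.-integrable D (EFin \o (fun y => c j * g j y)).
  rewrite (_ : EFin \o _ = (fun y => (c j)%:E * (g j y)%:E))%E; last exact/funext.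
  apply: integrableZl => //. exact: gi.
under eq_Rintegral do rewrite big_cons.
rewrite RintegralD// ?RintegralZl// ?IHr ?big_cons//.
rewrite (_ : EFin \o _ = (fun y => \sum_(j <- r) (c j * g j y)%:E))%E; last first.
  by apply/funext => y; rewrite /= sumEFin.
by apply: integrable_sum => // j _; exact: ci.
Qed.

Hypotheses (W0 : 0 < W) (W2 : W < 1 / 2).

(** Points of [D] differ by less than 1, so the kernel is the Dirichlet kernel, which [sum_casM]
    separates into [N] products. *)
Lemma dpss_opE (f : R -> R) x : mu.-integrable D (EFin \o f) -> D x ->
  dpss_op N W f x = \sum_(k < N) moment f k * cas N k x.
Proof.
move: (W0) (W2) => w0 w2 fi Dx.
transitivity (\int[mu]_(y in D) (\sum_(k < N) cas N k x * (cas N k y * f y))).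
  apply: eq_Rintegral => y; rewrite inE => Dy.
  rewrite dpss_kernelE; last first.
    by move: Dx Dy; rewrite /D /= !in_itv/= ltr_norml => /andP[? ?] /andP[? ?]; lra.
  by rewrite -sum_casM mulr_suml; apply: eq_bigr => k _; ring.
rewrite (@Rintegral_sumZ _ _ (fun k : 'I_N => cas N k x)); last by move=> k; exact: integrable_casM.
by apply: eq_bigr => k _; rewrite mulrC.
Qed.

Lemma Rintegral_ooE (f : R -> R) : cts (- W) W f ->
  \int[mu]_(x in D) f x = cint (- W) W f.
Proof.
move=> cf; have h := cts_integrable cf.
rewrite /D Rintegral_itv_bndo_bndc; last exact: integrable_cts.
rewrite Rintegral_itv_obnd_cbnd//.
by apply: integrableS h => //; by apply: subset_itvr; rewrite bnd_simp.
Qed.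

(** The eigenvalue equation is multiplied by each [cas N k] and integrated; [dpss_opE] turns its
    left side into a combination of Gram entries. *)
Lemma moment_gram (f : R -> R) (l : R) : in_eigenspace N W l f ->
  (\row_k moment f k) *m gram N (- W) W = l *: \row_k moment f k.
Proof.
move=> [lf hf]; have fi := integrable_itv_measure lf.
have hae := ae_itv_measureP hf.
apply/rowP => k; rewrite !mxE.
have ck : cts (- W) W (@cas R N k) by exact: cts_cas.
transitivity (\int[mu]_(x in D) (\sum_(i < N) moment f i * (cas N k x * cas N i x))).
  rewrite (@Rintegral_sumZ _ _ (fun i : 'I_N => moment f i)); last first.
    by move=> i; apply: integrable_cts; exact: cts_casM.
  apply: eq_bigr => i _; rewrite !mxE Rintegral_ooE; last exact: cts_casM.
  by congr (_ * _); apply: eq_cint => x _; rewrite mulrC.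
rewrite -RintegralZl//; last exact: integrable_casM.
rewrite /Rintegral; congr fine; apply: ae_eq_integral => //.
- apply: (@measurable_int _ _ _ mu); apply: integrable_cts.
  by apply: cts_sum => i; apply: ctsM; [exact: cts_cst|exact: cts_casM].
- rewrite (_ : (fun _ => _) = (fun x => l%:E * (cas N k x * f x)%:E)%E); last exact/funext.
  by apply: (@measurable_int _ _ _ mu); apply: integrableZl => //; exact: integrable_casM.
- case: hae => A [mA A0 hA]; exists A; split => // x /= nx; apply: hA => /= hx.
  apply: nx => Dx; congr EFin; rewrite mulrCA -hx// dpss_opE// mulr_sumr; apply: eq_bigr => i _; ring.
Qed.

(** As [l] is nonzero, [dpss_opE] recovers an eigenfunction from its moments, so taking moments is
    injective modulo null sets and preserves independence. *)
Lemma eigenspace_dim_mx (l : R) d : l != 0 -> eigenspace_dim N W l d ->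
  exists2 E : 'M[R]_(d, N), row_free E & E *m gram N (- W) W = l *: E.
Proof.
move=> l0 [e [he hind _]].
exists (\matrix_(i, k) moment (e i) k); last first.
  apply/row_matrixP => i; rewrite row_mul linearZ/=.
  have -> : row i (\matrix_(i, k) moment (e i) k) = \row_k moment (e i) k :> 'rV[R]_N.
    by apply/rowP => k; rewrite !mxE.
  exact: moment_gram.
rewrite -kermx_eq0; apply/rowV0P => v /sub_kermxP vE.
have hv (k : 'I_N) : \sum_i v 0 i * moment (e i) k = 0.
  transitivity ((v *m \matrix_(i, k) moment (e i) k) 0 k); last by rewrite vE mxE.
  by rewrite mxE; apply: eq_bigr => i _; rewrite mxE.
apply/rowP => i; rewrite mxE; apply: (hind (v 0)) => {i}.
have hall : \forall x \ae itv_measure W, forall i, dpss_op N W (e i) x = l * e i x.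
  by apply: filter_forall => i; have [_] := he i.
have FF := ae_filter_ringOfSetsType (itv_measure W).
apply: (@filterS2 _ _ FF _ _ _ _ ae_itv_measure_in hall) => x Dx hx.
apply: (mulfI l0); rewrite mulr0 mulr_sumr.
transitivity (\sum_i \sum_(k < N) v 0 i * moment (e i) k * cas N k x).
  apply: eq_bigr => i _; rewrite mulrCA -hx dpss_opE//.
    by rewrite mulr_sumr; apply: eq_bigr => k _; rewrite mulrA.
  by apply: integrable_itv_measure; have [] := he i.
by rewrite exchange_big/= big1// => k _; rewrite -mulr_suml hv mul0r.
Qed.

End SpectralBridge.

(** * Bounds on the eigenvalues and the choice of the scale *)

Section EigenvalueBound.
Context {R : realType}.

Lemma eigenvalue_eigenbasis (N : nat) (W : R) (lam : 'I_N -> R) :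
    0 < W -> W < 1 / 2 -> eigenvalue_list W lam ->
  exists2 V : 'M[R]_N, V *m V^T = 1%:M &
    V *m gram N (- W) W = diag_mx (\row_i lam i) *m V.
Proof.
move=> W0 W2 [_ lam0 hdim]; apply: symmetric_eigenbasis; first exact: gram_tr.
by move=> i; apply: eigenspace_dim_mx => //; exact: hdim.
Qed.

(** Over a whole period the Gram matrix is the identity, and its part over [[W, 1 - W]] is positive
    semidefinite. *)
Lemma eigenvalue_le1 (N : nat) (W : R) (lam : 'I_N -> R) (V : 'M[R]_N) i :
    0 < W -> W < 1 / 2 -> V *m V^T = 1%:M ->
    V *m gram N (- W) W = diag_mx (\row_i lam i) *m V ->
  lam i <= 1.
Proof.
move=> W0 W2 VV VG.
have h : (V *m gram N (- W) (- W + 1) *m V^T) i i = 1.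
  by rewrite gram_period mulmx1 VV mxE eqxx.
move: h; rewrite [- W + 1]addrC (@gram_cat _ N W); [|lra..].
have e : (V *m gram N (- W) W *m V^T) i i = lam i.
  by rewrite VG -mulmxA VV mulmx1 !mxE eqxx mulr1n.
have p : 0 <= (V *m gram N W (1 - W) *m V^T) i i.
  by rewrite gram_quad cint_ge0// => x _; rewrite -expr2 sqr_ge0.
by rewrite mulmxDr mulmxDl mxE e; lra.
Qed.

Lemma eigenvalue_sqr_le (N : nat) (W : R) (lam : 'I_N -> R) (V : 'M[R]_N) (n : 'I_N)
    (B K : nat) :
    0 < W -> W < 1 / 2 -> eigenvalue_list W lam -> V *m V^T = 1%:M ->
    V *m gram N (- W) W = diag_mx (\row_i lam i) *m V -> 0 <= lam n ->
    (0 < B)%N -> 2 * pi * N%:R * W <= 2 ^+ B ->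
  lam n ^+ 2 * ((n.+1 - (4 * B * K + 2 * K))%:R - 2 * N%:R * W)
    <= (B + 18)%:R * (1 / 4) ^+ K.
Proof.
move=> W0 W2 [mono _ _] VV VG n0 B0 hB.
(* The list is nonincreasing, so the first [n.+1] eigenvectors have eigenvalues at least [lam n]. *)
pose w (i : 'I_n.+1) : 'I_N := widen_ord (ltn_ord n) i.
pose V1 := rowsub w V.
have V1E : V1 *m V1^T = 1%:M.
  apply/matrixP => i j.
  transitivity ((V *m V^T) (w i) (w j)); last by rewrite VV !mxE.
  by rewrite !mxE; apply: eq_bigr => k _; rewrite !mxE.
have V1G : V1 *m gram N (- W) W = diag_mx (\row_i lam (w i)) *m V1.
  apply/matrixP => i j.
  transitivity ((V *m gram N (- W) W) (w i) j).
    by rewrite !mxE; apply: eq_bigr => k _; rewrite !mxE.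
  by rewrite VG !mul_diag_mx !mxE.
apply: (@trace_lower_bound _ N n.+1 _ (gram N (- W) W) (moments N B K W) V1
  (fun i => lam (w i))) => //.
- exact: gram_tr.
- move=> i; rewrite mono ?(eigenvalue_le1 _ W0 W2 VV VG)//.
  by rewrite /= -ltnS.
- by move=> d M MM; apply: trace_gram_le => //; exact: ltW.
- by move=> d M MM MF; exact: (trace_moments_le W0 W2 B0 hB MM MF).
Qed.

(** For the least [B], minimality gives 2 ^ (B - 1) < 2 c, which ln 2 >= 1 / 2 turns into a bound on
    [B]. *)
Lemma dyadic_scale (c : R) : 1 <= c ->
  exists B : nat, [/\ (0 < B)%N, 2 * c <= 2 ^+ B & B%:R <= 2 * (ln c + 5)].
Proof.
move=> c1; have hex : exists B : nat, 2 * c <= 2 ^+ B.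
  exists (Num.bound (2 * c)); apply: ltW.
  have h : 2 * c < (Num.bound (2 * c))%:R.
    by apply: archi_boundP; lra.
  by apply: (lt_trans h); rewrite -natrX ltr_nat ltn_expl.
case: (ex_minnP hex) => -[|B] hB hmin; first by move: hB; rewrite expr0; lra.
exists B.+1; split => //.
have hlt : 2 ^+ B < 2 * c.
  by rewrite ltNge; apply/negP => /hmin; rewrite ltnn.
have l2 : 1 / 2 <= ln (2 : R).
  have := @le_ln1Dx R (- (1 / 2)); rewrite (_ : 1 + - (1 / 2) = 2^-1); last by lra.
  by rewrite lnV ?posrE//; lra.
have lc := ln_ge0 c1.
have c0 : 0 < c by lra.
have : ln (2 ^+ B) <= ln (2 * c) by rewrite ler_ln ?posrE ?exprn_gt0 ?mulr_gt0// ltW.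
rewrite lnXn// lnM ?posrE// -[_ *+ B]mulr_natr => h.
have := ler0n R B; rewrite -natr1; nra.
Qed.

End EigenvalueBound.

Theorem mainTheorem5 (R : realType) :
  exists2 eta : R, 0 < eta &
    forall (N : nat) (W : R) (lam : 'I_N -> R),
      (1 <= N)%N -> 0 < W -> W < 1 / 2 ->
      eigenvalue_list W lam ->
      forall n : 'I_N,
        2 * N%:R * W + ln (pi * N%:R * W) + 6 <= n%:R ->
        n%:R <= pi * N%:R * W ->
        lam n <= 2 * expR (- (eta * ((n%:R - 2 * N%:R * W)
                                       / (ln (pi * N%:R * W) + 5)))).
Proof.
(* 108 is 6 times 18: [K] is about x / 18, and a sixth root is taken at the end. *)
exists (1 / 108); first lra.
move=> N W lam N1 W0 W2 hlam n hn hnc.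
have [V VV VG] := eigenvalue_eigenbasis W0 W2 hlam.
have le1 := eigenvalue_le1 n W0 W2 VV VG.
have hpi := @pi_gt0 R.
have N0 : 0 < N%:R :> R by rewrite ltr0n.
set c := pi * N%:R * W in hn hnc *.
have c0 : 0 < c by rewrite /c !mulr_gt0.
have NW0 : 0 < N%:R * W by rewrite mulr_gt0.
set x := (n%:R - 2 * N%:R * W) / (ln c + 5).
have [c1|c1] := ltP c 1.
  (* Here [n = 0] and [ln c + 5] may vanish or be negative. *)
  have n0 : n%:R = 0 :> R.
    have : n%:R < 1 :> R by apply: le_lt_trans hnc c1.
    by rewrite (ltr_nat R n 1) ltnS leqn0 => /eqP ->.
  have x1 : x <= 1.
    rewrite /x; have [L0|L0|L0] := ltgtP (ln c + 5) 0; last by rewrite L0 invr0 mulr0.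
      by rewrite ler_ndivrMr//; rewrite n0 in hn *; lra.
    by rewrite ler_pdivrMr//; rewrite n0 in hn *; lra.
  have := @expR_ge1Dx R (- (1 / 108 * x)); lra.
(* Positivity is not a clause of [eigenvalue_list]; a nonpositive value satisfies the bound
   trivially. *)
have [l0|l0] := leP (lam n) 0.
  by apply: le_trans l0 _; rewrite mulr_ge0// expR_ge0.
have [B [B0 hB BL]] := dyadic_scale c1.
have lc := ln_ge0 c1.
set L := ln c + 5 in x BL *.
have L5 : 5 <= L by rewrite /L; lra.
set m := n%:R - 2 * N%:R * W in x *.
have mL : L + 1 <= m by rewrite /m /L; lra.
have x0 : 0 <= x / 18 by rewrite /x !divr_ge0//; lra.
have xL : x * L = m by rewrite /x divfK//; apply/negP => /eqP; lra.
(* With B <= 2 L and 2 <= L, the number 4 B K + 2 K of conditions is at most 9 L K, and the divisor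
   18 makes this at most m / 2. *)
have [K [K1 K2]] : exists K : nat, K%:R <= x / 18 /\ x / 18 < K.+1%:R.
  by exists (Num.truncn (x / 18)); have /andP[] := truncn_itv x0.
have hB' : 2 * pi * N%:R * W <= 2 ^+ B by apply: le_trans hB; rewrite /c; lra.
have := eigenvalue_sqr_le K W0 W2 hlam VV VG (ltW l0) B0 hB'.
set q := (1 / 4) ^+ K => h1.
have q0 : 0 < q by rewrite exprn_gt0.
have h2 : L / 2 <= (n.+1 - (4 * B * K + 2 * K))%:R - 2 * N%:R * W.
  have hsub (a b : nat) : a%:R - b%:R <= (a - b)%:R :> R.
    by rewrite lerBlDr -natrD ler_nat addnC -leq_subLR.
  have := hsub n.+1 (4 * B * K + 2 * K)%N.
  have : (4 * B * K + 2 * K)%:R <= m / 2 :> R.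
    have K0 := ler0n R K.
    have a1 : B%:R * K%:R <= 2 * L * K%:R :> R by rewrite ler_wpM2r.
    have a2 : L * K%:R <= L * (x / 18) by rewrite ler_wpM2l//; lra.
    have a3 : 2 * K%:R <= L * K%:R :> R by rewrite ler_wpM2r//; lra.
    have a4 : L * (x / 18) = m / 18 by rewrite -xL; lra.
    rewrite natrD !natrM -[4%:R * _ * _]mulrA -mulrA in a1 *.
    move: (B%:R * K%:R) (L * K%:R) a1 a2 a3 a4 => b l a1 a2 a3 a4; lra.
  by rewrite -[n.+1%:R]natr1; move: mL; rewrite /m; lra.
have h3 : (B + 18)%:R <= 6 * L by rewrite natrD; lra.
have h4 : lam n ^+ 2 <= 12 * q.
  have a1 : lam n ^+ 2 * (L / 2) <= 6 * L * q.
    apply: (@le_trans _ _ ((B + 18)%:R * q)); last by rewrite ler_pM2r.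
    by apply: le_trans h1; rewrite ler_wpM2l ?sqr_ge0.
  rewrite -(@ler_pM2r _ (L / 2)); last by lra.
  by apply: le_trans a1 _; lra.
have e1 : 1 / 4 <= expR (- 1 : R).
  have h : 1 / 2 <= expR (- (1 / 2) : R) by have := @expR_ge1Dx R (- (1 / 2)); lra.
  have -> : -1 = - (1 / 2) + - (1 / 2) :> R by lra.
  by rewrite expRD; nra.
set y := expR _.
have y0 : 0 < y by exact: expR_gt0.
(* Since 1 / 4 <= exp (- 1) and K + 1 > x / 18, the power (1 / 4) ^ (K + 1) is at most exp (- x /
   18) = y ^ 6; the factor 4 returns from K + 1 to K. *)
have h5 : q <= 4 * y ^+ 6.
  have : (1 / 4) ^+ K.+1 <= y ^+ 6.
    apply: (@le_trans _ _ (expR (- 1) ^+ K.+1)); first by rewrite lerXn2r ?nnegrE ?expR_ge0.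
    rewrite /y -!expRM_natl ler_expR; lra.
  by rewrite exprS -/q; lra.
(* The sixth power is at most the square because 0 < [lam n] <= 1; then 12 q <= 48 y ^ 6 <= 64 y ^
   6. *)
have h6 : lam n ^+ 6 <= (2 * y) ^+ 6.
  apply: (@le_trans _ _ (lam n ^+ 2)).
    rewrite (_ : 6 = 2 + 4)%N// exprD ler_piMr ?sqr_ge0// exprn_ile1//; exact: ltW.
  apply: le_trans h4 _; rewrite exprMn (_ : 2 ^+ 6 = 64 :> R); last by rewrite -natrX.
  by have := exprn_gt0 6 y0; lra.
by move: h6; rewrite ler_pXn2r// nnegrE ?(ltW l0)// mulr_ge0// ltW.
Qed.
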